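(* Let $\psi$ be a positive non-decreasing continuous function defined on $[1,\infty)$, and let $$I(\psi)=\int_1^\infty \psi(\lambda)\, e^{-\psi(\lambda)^2/2}\,\frac{d\lambda}{\lambda}\in[0,\infty].$$ In the fair-coin game (with initial capital $\alpha>0$), writing $S_n=x_1+\dots+x_n$: (1) if $I(\psi)<\infty$, then Skeptic can force the event that $S_n<\sqrt{n}\,\psi(n)$ for all but finitely many $n$; (2) if $I(\psi)=\infty$, then Skeptic can force the event that $S_n\ge\sqrt{n}\,\psi(n)$ for infinitely many $n$.
   Context: Fair-coin game with initial capital $\alpha>0$. There are two players, Skeptic and Reality. Set $\mathcal{K}_0:=\alpha$. For $n=1,2,\dots$: Skeptic announces $M_n\in\mathbb{R}$; then Reality announces $x_n\in\{-1,1\}$; then $\mathcal{K}_n:=\mathcal{K}_{n-1}+M_n x_n$. Collateral duties: Skeptic must keep $\mathcal{K}_n$ non-negative; Reality must keep $\mathcal{K}_n$ from tending to infinity. A strategy for Skeptic is a rule that determines, for each $n\ge1$, the bet $M_n$ as a function of Reality's past moves $x_1,\dots,x_{n-1}$. An event is a set $E\subseteq\{-1,1\}^{\mathbb{N}}$ of infinite sequences $x_1x_2\dots$ of Reality's moves. ''Skeptic can force $E$'' (standard game-theoretic probability terminology of Shafer and Vovk) means: Skeptic has a strategy such that, for every sequence $(x_n)_{n\ge1}\in\{-1,1\}^{\mathbb{N}}$, the resulting capital satisfies $\mathcal{K}_n\ge0$ for all $n$, and either $(x_n)_{n\ge1}\in E$ or $\mathcal{K}_n\to\infty$ as $n\to\infty$.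 *)

(* Defs.v *)
From HB Require Import structures.
From mathcomp Require Import all_boot all_order all_algebra.
From mathcomp Require Import all_classical all_reals all_analysis.
Set Implicit Arguments.
Unset Strict Implicit.
Unset Printing Implicit Defensive.
Import Order.TTheory GRing.Theory Num.Theory.
Import numFieldNormedType.Exports.
Local Open Scope classical_set_scope.
Local Open Scope ring_scope.

(* A sequence of moves x_1 x_2 ... is a function x : nat -> R indexed from 0:
   the move of round n.+1 is x n. *)
Definition reality_path {R : realType} (x : nat -> R) : Prop :=
  forall n, x n = -1 \/ x n = 1.

(* The bet of round n.+1 is the value at [:: x 0; ...; x n.-1]; only values
   on lists with entries -1 and 1 ever matter. *)
Definition strategy (R : realType) : Type := seq R -> R.

Fixpoint capital {R : realType} (alpha : R) (M : strategy R) (x : nat -> R)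
    (n : nat) : R :=
  if n is n'.+1 then capital alpha M x n' + M (mkseq x n') * x n'
  else alpha.

Definition can_force {R : realType} (alpha : R) (E : set (nat -> R)) : Prop :=
  exists M : strategy R, forall x : nat -> R, reality_path x ->
    (forall n, 0 <= capital alpha M x n) /\
    (E x \/ capital alpha M x @ \oo --> +oo).

Definition partial_sum {R : realType} (x : nat -> R) (n : nat) : R :=
  \sum_(i < n) x i.

Definition psi_integral {R : realType} (psi : R -> R) : \bar R :=
  (\int[lebesgue_measure]_(l in `[1%R, +oo[)
     (psi l * expR (- (psi l ^+ 2) / 2) / l)%:E)%E.

(* Main.v *)
Require Import Defs.
From HB Require Import structures.
From mathcomp Require Import all_boot all_order all_algebra.
From mathcomp Require Import all_classical all_reals all_analysis.
From mathcomp Require Import measurable_realfun.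
From mathcomp Require Import ring lra zify.

(* Both parts rest on one family of martingales, exp(g S_n) / cosh(g)^n with
   slopes g = i / 2^k for integers i, and on the grid 4^k: writing r = sqrt n / 2^k
   and S_n = q sqrt n, the logarithm of such a martingale is about
   q^2 / 2 - (i r - q)^2 / 2, so for n of order 4^k the sum over i is of order
   exp(q^2 / 2).  By monotonicity of psi, I(psi) is finite if and only if the sum
   over k of phi(psi(4^k)) is, where phi(p) = p exp(-p^2 / 2).

   Upper class.  With p = psi(4^k), the portfolio weighting by exp(2 - p^2 / 2) the
   slopes i / 2^k with i <= p costs at most C phi(p) and is worth at least 1 when
   S_n >= sqrt n psi(n) for some n in [4^k, 4^(k+1)); the costs are summable, and a
   game-theoretic Borel-Cantelli lemma concludes.

   Lower class.  Let Q be the sum over many blocks k of exp(-p_k^2 / 2) times the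
   martingales with slopes i / 2^k, p_k < i <= 2 p_k + 1, each frozen at time
   4^(k+2).  Its initial value W tends to infinity with the number of blocks, while
   as long as the path stays below the boundary Q <= (1 + e) W + O(1), and
   Q <= e W once all the terms are frozen.  Selling Q short therefore multiplies by
   about 1 / (2 e) the capital of Skeptic on every path which stays below the
   boundary from time N on. *)

Set Implicit Arguments.
Unset Strict Implicit.
Unset Printing Implicit Defensive.
Import Order.TTheory GRing.Theory Num.Theory.
Import numFieldNormedType.Exports.
Local Open Scope classical_set_scope.
Local Open Scope ring_scope.

(** * Betting strategies *)

Lemma capitalE (R : realType) (a : R) (M : strategy R) x n :
  capital a M x n = a + \sum_(i < n) M (mkseq x i) * x i.
Proof.
elim: n => [|n IH] /=; first by rewrite big_ord0 addr0.
by rewrite IH big_ord_recr /= addrA.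
Qed.

Lemma capital_sum (R : realType) (I : Type) (r : seq I) (P : pred I)
    (a : I -> R) (M : I -> strategy R) x n :
  capital (\sum_(j <- r | P j) a j) (fun s => \sum_(j <- r | P j) M j s) x n =
  \sum_(j <- r | P j) capital (a j) (M j) x n.
Proof.
rewrite capitalE (eq_bigr _ (fun j _ => capitalE (a j) (M j) x n)) big_split /=.
by rewrite exchange_big /=; congr (_ + _); apply: eq_bigr => i _; rewrite mulr_suml.
Qed.

Lemma capitalZ (R : realType) (c a : R) (M : strategy R) x n :
  capital (c * a) (fun s => c * M s) x n = c * capital a M x n.
Proof.
rewrite !capitalE mulrDr mulr_sumr; congr (_ + _).
by apply: eq_bigr => i _; rewrite mulrA.
Qed.

Lemma capitalD (R : realType) (a b : R) (M : strategy R) x n :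
  capital (a + b) M x n = a + capital b M x n.
Proof. by rewrite !capitalE addrA. Qed.

Lemma capital_freeze (R : realType) (a : R) (M : strategy R) (T : nat) x n :
  capital a (fun s => if (size s < T)%N then M s else 0) x n =
  capital a M x (minn n T).
Proof.
elim: n => [|n IH]; first by rewrite min0n.
rewrite /= IH size_mkseq; have [nT|Tn] := boolP (n < T)%N.
  by rewrite (minn_idPl (ltnW nT)) (minn_idPl nT).
rewrite -leqNgt in Tn.
by rewrite mul0r addr0 (minn_idPr Tn) (minn_idPr (leqW Tn)).
Qed.

(** All prefixes are tested, the whole history included, so once [P] has held every later bet is
    zero, even if [P] fails again. *)
Definition stopped (R : realType) (P : pred (seq R)) (M : strategy R) :
    strategy R :=
  fun s => if [exists i : 'I_(size s).+1, P (take i s)] then 0 else M s.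

Lemma take_mkseq (T : Type) (f : nat -> T) (i n : nat) :
  (i <= n)%N -> take i (mkseq f n) = mkseq f i.
Proof. by move=> le_in; rewrite /mkseq -map_take take_iota (minn_idPl le_in). Qed.

(** The witness [m] is the minimum of [n] and the first time at which [P] holds. *)
Lemma capital_stopped (R : realType) (P : pred (seq R)) (a : R)
    (M : strategy R) x n :
  exists2 m, (m <= n)%N &
    [/\ capital a (stopped P M) x n = capital a M x m,
        forall i, (i < m)%N -> ~~ P (mkseq x i) &
        m = n \/ P (mkseq x m)].
Proof.
elim: n => [|n [m le_mn [cE nP mP]]]; first by exists 0%N => //; split => //; left.
rewrite /= /stopped; case: existsP => [[i Pi]|nex].
  exists m; first exact: leqW.
  split=> //; first by rewrite mul0r addr0.
  case: mP => [mE|]; last by right.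
  right; have ile : (i <= n)%N by rewrite -ltnS -[X in (_ < X.+1)%N](size_mkseq x).
  rewrite take_mkseq // in Pi.
  case: (ltnP i m) => [/nP|]; first by rewrite Pi.
  by move=> mi; rewrite (_ : m = i) //; apply/eqP; rewrite eqn_leq mi mE.
have nPx i : (i <= n)%N -> ~~ P (mkseq x i).
  move=> le_in; apply/negP => Pi; apply: nex.
  have lei : (i < (size (mkseq x n)).+1)%N by rewrite size_mkseq ltnS.
  by exists (Ordinal lei) => /=; rewrite take_mkseq.
have mn : m = n.
  by case: mP => // Pm; move: (nPx m le_mn); rewrite Pm.
exists n.+1 => //; split; last by left.
  by move: cE; rewrite mn => ->.
by move=> i; rewrite ltnS => /nPx.
Qed.

Lemma eq_capital (R : realType) (a : R) (M : strategy R) (x y : nat -> R) n :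
  (forall i, (i < n)%N -> x i = y i) -> capital a M x n = capital a M y n.
Proof.
move=> xy; rewrite !capitalE; congr (_ + _); apply: eq_bigr => i _.
rewrite xy //; congr (M _ * _); rewrite /mkseq; apply/eq_in_map => j.
by rewrite mem_iota add0n => ji; apply: xy; apply: ltn_trans (ltn_ord i).
Qed.

(** Reality may answer with either sign, so a bet larger than the current capital could make the
    next capital negative. *)
Lemma bet_le_capital (R : realType) (a : R) (M : strategy R) :
  (forall x, reality_path x -> forall n, 0 <= capital a M x n) ->
  forall x, reality_path x -> forall n,
    `|M (mkseq x n)| <= capital a M x n.
Proof.
move=> Mge0 x xpath n.
have key (e : R) : e = -1 \/ e = 1 -> 0 <= capital a M x n + M (mkseq x n) * e.
  move=> he; pose y i := if i == n then e else x i.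
  have yx i : (i < n)%N -> y i = x i.
    by move=> lt_in; rewrite /y (ltn_eqF lt_in).
  have ypath : reality_path y by move=> i; rewrite /y; case: eqP.
  have := Mge0 y ypath n.+1; rewrite /= (eq_capital a M yx) {2}/y eqxx.
  suff -> : mkseq y n = mkseq x n by [].
  rewrite /mkseq; apply/eq_in_map => j.
  by rewrite mem_iota add0n => /yx.
rewrite ler_norml; apply/andP; split.
  by have := key 1 (or_intror erefl); rewrite mulr1; lra.
by have := key (-1) (or_introl erefl); rewrite mulrN1; lra.
Qed.

(** By [bet_le_capital] a round at most doubles the capital. In a fixed round this bounds the bets
    of infinitely many strategies by a common multiple of their initial capitals. *)
Lemma capital_le_pow2 (R : realType) (a : R) (M : strategy R) :
  (forall x, reality_path x -> forall n, 0 <= capital a M x n) ->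
  forall x, reality_path x -> forall n, capital a M x n <= 2 ^+ n * a.
Proof.
move=> Mge0 x xpath; elim=> [|n IH]; first by rewrite expr0 mul1r.
have := bet_le_capital Mge0 xpath n; rewrite ler_norml => /andP[h1 h2].
by rewrite exprS /=; case: (xpath n) => ->; lra.
Qed.

(* The portfolio running all the strategies at once is worth at least the number of
   indices k whose own capital is eventually at least 1. *)
Lemma can_force_borel_cantelli (R : realType) (alpha B : R) (E : set (nat -> R))
    (v : nat -> R) (M : nat -> strategy R) :
  0 < alpha ->
  (forall k x, reality_path x -> forall n, 0 <= capital (v k) (M k) x n) ->
  (forall m, \sum_(k < m) v k <= B) ->
  (forall x, reality_path x -> ~ E x -> forall K, exists2 k, (K <= k)%N &
     \forall n \near \oo, 1 <= capital (v k) (M k) x n) ->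
  can_force alpha E.
Proof.
move=> alpha0 Mge0 vB ME.
have vge0 k : 0 <= v k by have := Mge0 k (fun=> 1) (fun=> or_intror erefl) 0%N.
(* The portfolio starts from [C], which covers all the initial capitals, the surplus staying in
   cash. The added 1 makes [C] positive, since rescaling to [alpha] divides by it. *)
pose C := B + 1.
have C0 : 0 < C by have := vB 0%N; rewrite big_ord0 /C; lra.
have aC0 : 0 < alpha / C by rewrite divr_gt0.
pose Msum s := limn (series (fun k => M k s)).
pose cap k x n := capital (v k) (M k) x n.
(* The bets of one round are dominated by [2 ^+ n * v k], which is summable in k. *)
have cvgM x n : reality_path x -> cvgn (series (fun k => M k (mkseq x n))).
  move=> xp; apply: normed_cvg.
  apply: (@series_le_cvg _ _ (fun k => 2 ^+ n * v k)) => [k|k|k|].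
  - exact: normr_ge0.
  - by rewrite mulr_ge0 // exprn_ge0.
  - apply: le_trans (bet_le_capital (Mge0 k) xp n) _.
    exact: (capital_le_pow2 (Mge0 k) xp).
  - apply: nondecreasing_is_cvgn.
      by apply: nondecreasing_series => k _ _; rewrite mulr_ge0 // exprn_ge0.
    exists (2 ^+ n * B) => _ [m _ <-]; rewrite seriesEord /= -mulr_sumr.
    by apply: ler_wpM2l; [exact: exprn_ge0 | exact: vB].
have cvgcap x n : reality_path x ->
    (fun m => C + \sum_(k < m) (cap k x n - v k)) @ \oo --> capital C Msum x n.
  move=> xp; elim: n => [|n IH].
    rewrite /= (_ : (fun m => _) = fun=> C); first exact: cvg_cst.
    apply/funext => m; rewrite big1 ?addr0 // => i _.
    by rewrite /cap /= subrr.
  rewrite /= (_ : (fun m => _) = fun m =>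
     (C + \sum_(k < m) (cap k x n - v k)) +
     series (fun k => M k (mkseq x n)) m * x n); last first.
    apply/funext => m; rewrite -[RHS]addrA; congr (_ + _).
    rewrite seriesEord /= mulr_suml -big_split /=.
    by apply: eq_bigr => k _; rewrite /cap /=; ring.
  apply: cvgD; first exact: IH.
  by apply: cvgMl; exact: cvgM.
(* In the limit, the capitals of index at least [m] are non-negative and the cash covers every
   [v k], so each finite sub-portfolio bounds the whole from below. *)
have caplow x n m : reality_path x ->
    \sum_(k < m) cap k x n <= capital C Msum x n.
  move=> xp; have /cvgP cv := cvgcap x n xp.
  rewrite -(cvg_lim (@Rhausdorff R) (cvgcap x n xp)).
  apply: limr_ge => //; exists m => // m' /= le_mm'.
  rewrite sumrB -(subnKC le_mm') big_split_ord /=.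
  have h1 : 0 <= \sum_(i < m' - m) cap (rshift m i) x n.
    by apply: sumr_ge0 => i _; exact: Mge0.
  have := vB (m + (m' - m))%N; rewrite /C; move: h1.
  set a := \sum_(i < m' - m) _; set b := \sum_(i < m) _.
  set c := \sum_(i < _ + _) _; lra.
exists (fun s => (alpha / C) * Msum s) => x xp.
have capE n : capital alpha (fun s => alpha / C * Msum s) x n =
    alpha / C * capital C Msum x n.
  by rewrite -capitalZ divfK // gt_eqF.
split=> [n|].
  rewrite capE mulr_ge0 ?(ltW aC0) //.
  by have := caplow x n 0%N xp; rewrite big_ord0.
case: (pselect (E x)) => [|nE]; [by left|right].
have many j : exists m, \forall n \near \oo, j%:R <= \sum_(k < m) cap k x n.
  elim: j => [|j [m Hm]].
    by exists 0%N; near=> n; rewrite big_ord0.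
  have [k le_mk Hk] := ME x xp nE m.
  exists k.+1; near=> n; rewrite big_ord_recr /= -natr1 lerD //; last first.
    by near: n.
  apply: (@le_trans _ _ (\sum_(k0 < m) cap k0 x n)); first by near: n.
  rewrite -(subnKC le_mk) big_split_ord /= lerDl.
  by apply: sumr_ge0 => i _; exact: Mge0.
apply/cvgryPge => A.
have [m Hm] := many (Num.truncn (A * C / alpha)).+1.
near=> n; rewrite capE.
have : (Num.truncn (A * C / alpha)).+1%:R <= capital C Msum x n.
  by apply: le_trans (caplow x n m xp); near: n.
move=> h; have : A * C / alpha <= capital C Msum x n.
  by apply: le_trans h; apply/ltW/truncnS_gt.
rewrite ler_pdivrMr // -ler_pdivlMr //.
by rewrite [alpha / C * _]mulrC mulrA.
Unshelve. all: by end_near.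
Qed.

(** * Exponential martingales *)

Definition cosh (R : realType) (x : R) : R := (expR x + expR (- x)) / 2.

Lemma cosh_gt0 (R : realType) (x : R) : 0 < cosh x.
Proof. by rewrite divr_gt0 // addr_gt0 // expR_gt0. Qed.

Lemma cosh_coeff_even (R : realType) (x : R) j :
  exp_coeff x j.*2 + exp_coeff (- x) j.*2 = 2 * x ^+ j.*2 / j.*2`!%:R.
Proof.
rewrite /exp_coeff /= -mul2n exprM exprM sqrrN -exprM; ring.
Qed.

Lemma cosh_coeff_odd (R : realType) (x : R) j :
  exp_coeff x j.*2.+1 + exp_coeff (- x) j.*2.+1 = 0.
Proof.
by rewrite /exp_coeff /= exprNn -signr_odd /= odd_double expr1 mulN1r mulNr subrr.
Qed.

Lemma cosh_coeff_ge0 (R : realType) (x : R) j :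
  0 <= exp_coeff x j + exp_coeff (- x) j.
Proof.
rewrite -(odd_double_half j); case: (odd j); first by rewrite cosh_coeff_odd.
rewrite add0n cosh_coeff_even divr_ge0 // mulr_ge0 //.
by rewrite -mul2n exprM exprn_ge0 // sqr_ge0.
Qed.

Lemma cvg_series_cosh (R : realType) (x : R) :
  series (fun j => exp_coeff x j + exp_coeff (- x) j) @ \oo -->
  expR x + expR (- x).
Proof.
rewrite (_ : series _ = series (exp_coeff x) \+ series (exp_coeff (- x))).
  by apply: cvgD; exact: is_cvg_series_exp_coeff.
by apply/funext => n /=; rewrite !seriesEord /= big_split.
Qed.

Lemma fact_double_ge m : (2 ^ m * m`! <= m.*2`!)%N.
Proof.
elim: m => // m IH; rewrite doubleS !factS expnS.
have : (2 * m.+1 * (2 ^ m * m`!) <= m.*2.+2 * m.*2`!)%N.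
  by rewrite leq_mul // -mul2n; lia.
nia.
Qed.

(** The odd Taylor coefficients cancel, and the even ones compare termwise because 2^j j! is at most
    (2j)!; hence 2n terms on one side against n on the other. *)
Lemma cosh_le (R : realType) (x : R) : cosh x <= expR (x ^+ 2 / 2).
Proof.
rewrite ler_pdivrMr // -(cvg_lim (@Rhausdorff R) (cvg_series_cosh (x := x))).
apply: limr_le; first by apply/cvg_ex; eexists; exact: cvg_series_cosh.
apply: nearW => n.
have mono : {homo series (fun j => exp_coeff x j + exp_coeff (- x) j) :
    a b / (a <= b)%N >-> a <= b}.
  by apply: nondecreasing_series => k _ _; exact: cosh_coeff_ge0.
apply: (@le_trans _ _ (series
    (fun j => exp_coeff x j + exp_coeff (- x) j) n.*2)).
  by apply: mono; rewrite -addnn leq_addr.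
apply: (@le_trans _ _ (2 * series (exp_coeff (x ^+ 2 / 2)) n)); last first.
  rewrite mulrC ler_wpM2r // /expR.
  apply: nondecreasing_cvgn_le; last exact: is_cvg_series_exp_coeff.
  apply: nondecreasing_series => k _ _; apply: exp_coeff_ge0.
  by rewrite divr_ge0 // sqr_ge0.
rewrite !seriesEord /=.
elim: n {mono} => [|n IH]; first by rewrite !big_ord0 mulr0.
rewrite doubleS !big_ord_recr /= cosh_coeff_odd addr0 mulrDr lerD //.
rewrite cosh_coeff_even /exp_coeff /= -mulrA ler_wpM2l //.
rewrite expr_div_n -mulrA -exprM mul2n ler_wpM2l //.
  by rewrite -mul2n exprM exprn_ge0 // sqr_ge0.
rewrite -invfM -natrX -natrM lef_pV2 ?posrE ?ltr0n ?muln_gt0 ?expn_gt0 ?fact_gt0 //.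
by rewrite ler_nat fact_double_ge.
Qed.

(** The terms of the series are non-negative, and the first three add up to twice the left-hand
    side. *)
Lemma cosh_ge1Dsqr (R : realType) (x : R) : 1 + x ^+ 2 / 2 <= cosh x.
Proof.
rewrite ler_pdivlMr // -(cvg_lim (@Rhausdorff R) (cvg_series_cosh (x := x))).
apply: limr_ge; first by apply/cvg_ex; eexists; exact: cvg_series_cosh.
exists 3%N => // n /= n3.
have mono : {homo series (fun j => exp_coeff x j + exp_coeff (- x) j) :
    a b / (a <= b)%N >-> a <= b}.
  by apply: nondecreasing_series => k _ _; exact: cosh_coeff_ge0.
apply: le_trans (mono _ _ n3); rewrite seriesEord /=.
rewrite !big_ord_recr big_ord0 /= /exp_coeff /= !expr0 !expr1 sqrrN.
rewrite (_ : 0`! = 1)%N // (_ : 1`! = 1)%N // (_ : 2`! = 2)%N //.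
by rewrite le_eqVlt; apply/orP; left; apply/eqP; field.
Qed.

Lemma cosh_ge (R : realType) (x : R) :
  expR (x ^+ 2 / 2 - x ^+ 4 / 4) <= cosh x.
Proof.
(* exp (y - y^2) <= 1 + y for y = x^2 / 2, because (1 + y)(1 - y + y^2) = 1 + y^3. *)
apply: le_trans (cosh_ge1Dsqr x).
have y0 : 0 <= x ^+ 2 / 2 by rewrite divr_ge0 // sqr_ge0.
rewrite (_ : x ^+ 4 / 4 = (x ^+ 2 / 2) ^+ 2); last by field.
move: (x ^+ 2 / 2) y0 => y y0.
rewrite -opprB expRN.
have h : 0 < 1 + (y ^+ 2 - y) by nra.
apply: (@le_trans _ _ (1 + (y ^+ 2 - y))^-1).
  by rewrite lef_pV2 ?posrE ?expR_gt0 // expR_ge1Dx.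
by rewrite -[leLHS]mul1r ler_pdivrMr //; nra.
Qed.

Lemma cosh_ge1 (R : realType) (x : R) : 1 <= cosh x.
Proof. by apply: le_trans (cosh_ge1Dsqr x); have := sqr_ge0 x; lra. Qed.

Definition expmart (R : realType) (g : R) (x : nat -> R) (n : nat) : R :=
  expR (g * partial_sum x n) / cosh g ^+ n.

(* The ratio is tanh g, and e^{g x} / cosh g = 1 + x tanh g for x = 1 or -1. *)
Definition expbet (R : realType) (g : R) : strategy R := fun s =>
  expR (g * \sum_(y <- s) y) / cosh g ^+ (size s) *
  ((expR g - expR (- g)) / (2 * cosh g)).

Lemma sum_mkseq (R : realType) (x : nat -> R) n :
  \sum_(y <- mkseq x n) y = partial_sum x n.
Proof.
by rewrite /mkseq big_map -[X in iota 0 X]subn0 -/(index_iota 0 n) big_mkord.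
Qed.

Lemma capital_expbet (R : realType) (g : R) x n : reality_path x ->
  capital 1 (expbet g) x n = expmart g x n.
Proof.
move=> xp; elim: n => [|n IH].
  by rewrite /expmart /partial_sum /= big_ord0 mulr0 expR0 expr0 divr1.
rewrite /= IH /expbet size_mkseq sum_mkseq /expmart /partial_sum big_ord_recr /=.
rewrite -/(partial_sum x n) mulrDr expRD exprS.
have c0 : cosh g != 0 by rewrite gt_eqF // cosh_gt0.
have cn0 : cosh g ^+ n != 0 by rewrite expf_neq0.
have cE : expR g + expR (- g) = 2 * cosh g by rewrite /cosh; field.
case: (xp n) => ->; rewrite ?mulrN1 ?mulr1.
  have -> : expR (- g) = 2 * cosh g - expR g by rewrite -cE; ring.
  by field; rewrite c0 cn0.
have -> : expR (- g) = 2 * cosh g - expR g by rewrite -cE; ring.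
by field; rewrite c0 cn0.
Qed.

Lemma expmart_gt0 (R : realType) (g : R) x n : 0 < expmart g x n.
Proof. by rewrite divr_gt0 ?expR_gt0 // exprn_gt0 // cosh_gt0. Qed.

Lemma expmart_ge (R : realType) (g : R) x n :
  expR (g * partial_sum x n - n%:R * (g ^+ 2 / 2)) <= expmart g x n.
Proof.
rewrite expRB expRM_natl ler_wpM2l ?expR_ge0 //.
rewrite lef_pV2 ?posrE ?exprn_gt0 ?cosh_gt0 ?expR_gt0 //.
by rewrite lerXn2r ?nnegrE ?(ltW (cosh_gt0 _)) ?expR_ge0 // cosh_le.
Qed.

Lemma expmart_le (R : realType) (g : R) x n :
  expmart g x n <=
  expR (g * partial_sum x n - n%:R * (g ^+ 2 / 2 - g ^+ 4 / 4)).
Proof.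
rewrite expRB expRM_natl ler_wpM2l ?expR_ge0 //.
rewrite lef_pV2 ?posrE ?exprn_gt0 ?cosh_gt0 ?expR_gt0 //.
by rewrite lerXn2r ?nnegrE ?(ltW (cosh_gt0 _)) ?expR_ge0 // cosh_ge.
Qed.

Lemma expmart_le_exp (R : realType) (g : R) x n :
  expmart g x n <= expR (g * partial_sum x n).
Proof.
rewrite ler_pdivrMr ?exprn_gt0 ?cosh_gt0 // ler_peMr ?expR_ge0 //.
by rewrite exprn_ege1 // cosh_ge1.
Qed.

(** * The integral test on the grid 4^k *)

Definition efkp_weight (R : realType) (p : R) : R := p * expR (- (p ^+ 2) / 2).

(** Powers of 4 make [sqrt (4 ^+ k)] equal to [2 ^+ k], the denominator of the slopes at scale k. *)
Definition quad_itv (R : realType) (k : nat) : set R :=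
  `[4 ^+ k, 4 ^+ k.+1[%classic.

Lemma measurable_quad_itv (R : realType) k : measurable (@quad_itv R k).
Proof. exact: measurable_itv. Qed.

#[local] Hint Extern 0 (measurable (quad_itv _)) =>
  exact: measurable_quad_itv : core.

Lemma pow4_ge1 (R : realType) k : 1 <= 4 ^+ k :> R.
Proof. by rewrite exprn_ege1 // ler1n. Qed.

Lemma pow4_itv (R : realType) k : (4 ^+ k : R) \in `[1, +oo[.
Proof. by rewrite in_itv /= andbT pow4_ge1. Qed.

Lemma quad_itv_subset (R : realType) k :
  @quad_itv R k `<=` `[1, +oo[%classic.
Proof.
move=> l; rewrite /quad_itv /= !in_itv /= andbT => /andP[+ _].
exact: le_trans (pow4_ge1 R k).
Qed.

Lemma bigcup_quad_itv (R : realType) :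
  \bigcup_k @quad_itv R k = `[1, +oo[%classic.
Proof.
apply/seteqP; split=> [l [k _]|l]; first exact: quad_itv_subset.
rewrite /= in_itv /= andbT => l1.
have l0 : 0 <= l by apply: le_trans l1.
have n0 : (0 < Num.truncn l)%N by rewrite truncn_ge_nat.
have /andP[h1 h2] := @trunc_log_bounds 4 (Num.truncn l) isT n0.
have /andP[t1 t2] := truncn_itv l0.
exists (trunc_log 4 (Num.truncn l)) => //; rewrite /quad_itv /= in_itv /=.
rewrite -!natrX; apply/andP; split.
  by apply: le_trans t1; rewrite ler_nat.
by apply: lt_le_trans t2 _; rewrite ler_nat.
Qed.

Lemma trivIset_quad_itv (R : realType) : trivIset setT (@quad_itv R).
Proof.
have h i j (l : R) : @quad_itv R i l -> quad_itv j l -> (i <= j)%N.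
  rewrite /quad_itv /= !in_itv /= => /andP[h1 _] /andP[_ h2].
  have := le_lt_trans h1 h2; rewrite ltr_eXn2l ?ltnS //.
  by rewrite ltr1n.
move=> i j _ _ [l [li lj]]; apply/eqP.
by rewrite eqn_leq (h _ _ _ li lj) (h _ _ _ lj li).
Qed.

Lemma efkp_weight_gt0 (R : realType) (p : R) : 0 < p -> 0 < efkp_weight p.
Proof. by move=> p0; rewrite mulr_gt0 // expR_gt0. Qed.

(** This holds because exp(p^2 / 2) >= 1 + p^2 / 2 >= p. *)
Lemma efkp_weight_le1 (R : realType) (p : R) : efkp_weight p <= 1.
Proof.
have h := expR_ge1Dx (p ^+ 2 / 2); rewrite /efkp_weight mulNr expRN.
by rewrite ler_pdivrMr ?expR_gt0 // mul1r; apply: le_trans h; nra.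
Qed.

Lemma efkp_weight_ge (R : realType) (c p : R) :
  0 < c -> c <= p -> p <= 1 -> c / 2 <= efkp_weight p.
Proof.
move=> c0 cp p1; rewrite /efkp_weight.
have h := expR_ge1Dx (- (p ^+ 2) / 2).
have : 1 / 2 <= expR (- p ^+ 2 / 2) by apply: le_trans h; nra.
have := expR_gt0 (- p ^+ 2 / 2).
by move: (expR _) => e; nra.
Qed.

(* The weight increases on [0, 1]; the factor 1 + 2 / c pays for this. *)
Lemma efkp_weight_quasi_dec (R : realType) (c a b : R) :
  0 < c -> c <= a -> a <= b ->
  efkp_weight b <= (1 + 2 / c) * efkp_weight a.
Proof.
move=> c0 ca ab.
have a0 : 0 < a by apply: lt_le_trans ca.
have wa := efkp_weight_gt0 a0.
have c2 : 0 < 2 / c by rewrite divr_gt0.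
have [a1|a1] := lerP a 1.
  apply: le_trans (efkp_weight_le1 b) _.
  have := efkp_weight_ge c0 ca a1 => h.
  apply: (@le_trans _ _ (2 / c * efkp_weight a)); last by nra.
  rewrite mulrAC ler_pdivlMr //; lra.
(* Beyond 1 the weight decreases: b / a <= 1 + (b - a) <= 1 + (b^2 - a^2) / 2, which is at most the
   quotient of the exponentials. *)
apply: (@le_trans _ _ (efkp_weight a)); last by nra.
rewrite /efkp_weight !mulNr !expRN ler_pdivrMr ?expR_gt0 //.
rewrite mulrAC ler_pdivlMr ?expR_gt0 //.
have -> : expR (b ^+ 2 / 2) = expR (a ^+ 2 / 2) * expR (b ^+ 2 / 2 - a ^+ 2 / 2).
  by rewrite -expRD; congr expR; ring.
have h := expR_ge1Dx (b ^+ 2 / 2 - a ^+ 2 / 2).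
rewrite [leRHS]mulrCA mulrC ler_wpM2l ?expR_ge0 //.
apply: (@le_trans _ _ (a * (1 + (b ^+ 2 / 2 - a ^+ 2 / 2)))); last first.
  by rewrite ler_pM2l.
have : a * (b - a) * 1 <= a * (b - a) * ((a + b) / 2).
  by rewrite ler_wpM2l; nra.
nra.
Qed.

Lemma lebesgue_measure_quad_itv (R : realType) k :
  lebesgue_measure (@quad_itv R k) = (3 * 4 ^+ k)%:E.
Proof.
rewrite lebesgue_measure_itv /= lte_fin ltr_eXn2l ?ltr1n // ltnSn.
by rewrite -EFinD exprS; congr EFin; ring.
Qed.

Section integral_test.
Context (R : realType) (psi : R -> R).
Context (psi_gt0 : {in `[1, +oo[, forall l, 0 < psi l}).
Context (psi_nd : {in `[1, +oo[ &, {homo psi : l m / l <= m}}).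
Context (psi_cont : {within `[1, +oo[, continuous psi}).

Let integrand (l : R) := psi l * expR (- (psi l ^+ 2) / 2) / l.
Let C := 1 + 2 / psi 1.

Let one_itv : (1 : R) \in `[1, +oo[. Proof. by rewrite in_itv /= lexx. Qed.

Let C_gt0 : 0 < C.
Proof. by have := psi_gt0 one_itv => h; rewrite addr_gt0 // divr_gt0. Qed.

Let measurable_integrand :
  measurable_fun (`[1, +oo[%classic : set R) (fun l => (integrand l)%:E).
Proof.
have mpsi : measurable_fun (`[1, +oo[%classic : set R) psi.
  by apply: subspace_continuous_measurable_fun.
apply/measurable_EFinP; apply: measurable_funM; last first.
  apply: subspace_continuous_measurable_fun => //.
  have: {in `[1, +oo[%classic, continuous (@GRing.inv R)}.
    move=> l; rewrite inE /= in_itv /= andbT => l1.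
    by apply: inv_continuous; rewrite gt_eqF // (lt_le_trans ltr01 l1).
  exact: continuous_in_subspaceT.
apply: measurable_funM => //; apply: measurableT_comp => //.
apply: measurable_funM => //; apply: measurableT_comp => //.
exact: measurable_funX.
Qed.

Let integrand_ge0 l : (`[1, +oo[%classic : set R) l -> (0 <= (integrand l)%:E)%E.
Proof.
move=> l1; have l0 : 0 < l.
  by move: l1; rewrite /= in_itv /= andbT; apply: lt_le_trans.
by rewrite lee_fin divr_ge0 ?(ltW l0) // mulr_ge0 ?expR_ge0 // ltW // psi_gt0.
Qed.

Lemma psi_integral_blocks : psi_integral psi =
  (\sum_(k <oo) \int[lebesgue_measure]_(l in @quad_itv R k) (integrand l)%:E)%E.
Proof.
rewrite /psi_integral -bigcup_quad_itv.
rewrite ge0_integral_bigcup //.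
- by rewrite bigcup_quad_itv; exact: measurable_integrand.
- by rewrite bigcup_quad_itv; exact: integrand_ge0.
- exact: trivIset_quad_itv.
Qed.

Let msubset k : measurable_fun (@quad_itv R k) (fun l => (integrand l)%:E).
Proof.
by apply: measurable_funS measurable_integrand => //; exact: quad_itv_subset.
Qed.

(** By monotonicity of [psi] and [efkp_weight_quasi_dec], the weight inside the block compares, up
    to the factor [C], with its values at the two ends. The block has length 3 * 4^k, and there 1 /
    l lies between 4^-(k+1) and 4^-k. *)
Lemma block_integral_bounds k :
  ((efkp_weight (psi (4 ^+ k.+1)) * (3 / (4 * C)))%:E <=
   \int[lebesgue_measure]_(l in @quad_itv R k) (integrand l)%:E <=
   (3 * C * efkp_weight (psi (4 ^+ k)))%:E)%E.
Proof.
have k40 : 0 < 4 ^+ k :> R by rewrite exprn_gt0.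
have psi1 := psi_gt0 one_itv.
have psi1le l : 1 <= l -> psi 1 <= psi l.
  by move=> l1; apply: psi_nd => //; rewrite in_itv /= l1.
have w0 j : 0 < efkp_weight (psi (4 ^+ j)).
  by apply: efkp_weight_gt0; apply: psi_gt0; exact: pow4_itv.
apply/andP; split.
- pose r := efkp_weight (psi (4 ^+ k.+1)) / (C * 4 ^+ k.+1).
  have -> : (efkp_weight (psi (4 ^+ k.+1)) * (3 / (4 * C)))%:E =
      (\int[lebesgue_measure]_(l in @quad_itv R k) cst r%:E l)%E.
    rewrite integral_cst //= lebesgue_measure_quad_itv -EFinM; congr EFin.
    by rewrite /r exprS; field; rewrite !gt_eqF.
  apply: ge0_le_integral => //.
  + move=> l _; rewrite lee_fin divr_ge0 ?ltW // mulr_gt0 // exprn_gt0 //.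
  + exact: msubset.
  + move=> l lk; rewrite lee_fin /integrand /r.
    have l1 : 1 <= l by have := quad_itv_subset lk; rewrite /= in_itv /= andbT.
    have l0 : 0 < l by apply: lt_le_trans l1.
    move: lk; rewrite /quad_itv /= in_itv /= => /andP[kl lk].
    have h : efkp_weight (psi (4 ^+ k.+1)) <= C * efkp_weight (psi l).
      apply: efkp_weight_quasi_dec => //; first exact: psi1le.
      by apply: psi_nd; rewrite ?in_itv /= ?l1 ?pow4_ge1 //= ltW.
    rewrite -/(efkp_weight (psi l)) ler_pdivlMr // mulrAC ler_pdivrMr; last first.
      by rewrite mulr_gt0 // exprn_gt0.
    rewrite mulrA ler_pM ?(ltW l0) ?(ltW (w0 _)) ?(ltW lk) //.
    by rewrite mulrC.
- pose r := C * efkp_weight (psi (4 ^+ k)) / 4 ^+ k.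
  have -> : (3 * C * efkp_weight (psi (4 ^+ k)))%:E =
      (\int[lebesgue_measure]_(l in @quad_itv R k) cst r%:E l)%E.
    rewrite integral_cst //= lebesgue_measure_quad_itv -EFinM; congr EFin.
    by rewrite /r; field; rewrite !gt_eqF.
  apply: ge0_le_integral => //.
  + by move=> l lk; apply: integrand_ge0; exact: quad_itv_subset lk.
  + exact: msubset.
  + move=> l lk; rewrite lee_fin /integrand /r.
    have l1 : 1 <= l by have := quad_itv_subset lk; rewrite /= in_itv /= andbT.
    have l0 : 0 < l by apply: lt_le_trans l1.
    move: lk; rewrite /quad_itv /= in_itv /= => /andP[kl lk].
    have h : efkp_weight (psi l) <= C * efkp_weight (psi (4 ^+ k)).
      apply: efkp_weight_quasi_dec => //; first by apply: psi1le; exact: pow4_ge1.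
      by apply: psi_nd; rewrite ?in_itv /= ?l1 ?pow4_ge1 //.
    rewrite -/(efkp_weight (psi l)) ler_pM ?invr_ge0 ?(ltW l0) //.
      by rewrite ltW // efkp_weight_gt0 // (lt_le_trans psi1) // psi1le.
    by rewrite lef_pV2 ?posrE.
Qed.

Let block_ge0 k :
  (0 <= \int[lebesgue_measure]_(l in @quad_itv R k) (integrand l)%:E)%E.
Proof.
by apply: integral_ge0 => l lk; apply: integrand_ge0; exact: quad_itv_subset lk.
Qed.

Lemma efkp_series_bounded : (psi_integral psi < +oo)%E ->
  exists B, forall m, \sum_(k < m) efkp_weight (psi (4 ^+ k)) <= B.
Proof.
move=> Ioo; have I0 : (0 <= psi_integral psi)%E.
  by apply: integral_ge0 => l; exact: integrand_ge0.
have Ifin : psi_integral psi \is a fin_num by rewrite ge0_fin_numE.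
have D0 : 0 < 3 / (4 * C) by rewrite divr_gt0 // mulr_gt0.
exists (1 + fine (psi_integral psi) / (3 / (4 * C))) => m.
(* The integral over block k controls the term of index k + 1; the term of index 0 is left over and
   is at most 1. *)
apply: (@le_trans _ _ (\sum_(k < m.+1) efkp_weight (psi (4 ^+ k)))).
  rewrite big_ord_recr /= lerDl ltW // efkp_weight_gt0 // psi_gt0 //.
  exact: pow4_itv.
rewrite big_ord_recl /= lerD ?efkp_weight_le1 //.
rewrite ler_pdivlMr // mulr_suml -lee_fin -sumEFin fineK //.
rewrite psi_integral_blocks.
apply: le_trans (nneseries_lim_ge (m := 0%N) (P := xpredT) m _); last first.
  by move=> k _ _; exact: block_ge0.
rewrite big_mkord; apply: lee_sum => k _.
by have /andP[] := block_integral_bounds k.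
Qed.

Lemma efkp_series_unbounded : psi_integral psi = +oo%E ->
  forall B, exists m, B <= \sum_(k < m) efkp_weight (psi (4 ^+ k)).
Proof.
move=> Ioo B; apply: contrapT => nB.
have C3 : 0 < 3 * C by rewrite mulr_gt0.
have : (psi_integral psi <= (3 * C * B)%:E)%E.
  rewrite psi_integral_blocks; apply: lime_le.
    by apply: is_cvg_nneseries => k _ _; exact: block_ge0.
  apply: nearW => m; rewrite big_mkord.
  apply: (@le_trans _ _ (\sum_(k < m) (3 * C * efkp_weight (psi (4 ^+ k)))%:E)%E).
    by apply: lee_sum => k _; have /andP[] := block_integral_bounds k.
  rewrite sumEFin lee_fin -mulr_sumr ler_pM2l // leNgt; apply/negP => h.
  by apply: nB; exists m; exact: ltW.
by rewrite Ioo leNgt ltry.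
Qed.

End integral_test.

(** * The upper class *)

Definition mix (R : realType) (c : R) (g : nat -> R) (m : nat) : strategy R :=
  fun s => \sum_(i < m) c * expbet (g i) s.

Lemma capital_mix (R : realType) (c : R) (g : nat -> R) (m : nat) x n :
  reality_path x ->
  capital (m%:R * c) (mix c g m) x n = \sum_(i < m) c * expmart (g i) x n.
Proof.
move=> xp.
rewrite (_ : m%:R * c = \sum_(i < m) c * 1); last first.
  by rewrite sumr_const card_ord mulr1 mulr_natl.
rewrite capital_sum; apply: eq_bigr => i _.
by rewrite capitalZ capital_expbet.
Qed.

Lemma capital_stopped_reached (R : realType) (P : pred (seq R)) (a : R)
    (M : strategy R) x n0 n :
  (n0 <= n)%N -> P (mkseq x n0) ->
  exists2 m, (m <= n0)%N &
    P (mkseq x m) /\ capital a (stopped P M) x n = capital a M x m.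
Proof.
move=> le_n0n Pn0; have [m le_mn [-> nP mP]] := capital_stopped P a M x n.
have le_mn0 : (m <= n0)%N.
  by rewrite leqNgt; apply/negP => /nP; rewrite Pn0.
exists m => //; split => //.
case: mP => // mE; suff -> : m = n0 by [].
by apply/eqP; rewrite eqn_leq le_mn0 mE le_n0n.
Qed.

Lemma sqrt_pow4 (R : realType) k : Num.sqrt (4 ^+ k) = 2 ^+ k :> R.
Proof.
rewrite (_ : 4 = 2 ^+ 2 :> R); last by rewrite expr2 -natrM.
by rewrite -exprM mulnC exprM sqrtr_sqr ger0_norm // exprn_ge0.
Qed.

(** Here r = sqrt n / 2^k lies in [1, 2]. For i = floor(p / r), which is at most p, the number y = i
    r is within 2 of p, so the exponent y p - y^2 / 2 = p^2 / 2 - (p - y)^2 / 2 is at least p^2 / 2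
    - 2. *)
Lemma expmart_crossing (R : realType) (p : R) (k n : nat) x :
  0 < p -> (4 ^ k <= n)%N -> (n < 4 ^ k.+1)%N ->
  Num.sqrt n%:R * p <= partial_sum x n ->
  exists2 i, (i < (Num.truncn p).+1)%N &
    1 <= expR (2 - p ^+ 2 / 2) * expmart (i%:R / 2 ^+ k) x n.
Proof.
move=> p0 kn nk Sge.
have k20 : 0 < 2 ^+ k :> R by rewrite exprn_gt0.
pose r : R := Num.sqrt n%:R / 2 ^+ k.
have r1 : 1 <= r.
  rewrite ler_pdivlMr // mul1r -sqrt_pow4 ler_wsqrtr // -natrX ler_nat //.
have r2 : r <= 2.
  rewrite ler_pdivrMr // -exprS -sqrt_pow4 ler_wsqrtr // -natrX ler_nat.
  exact: ltnW.
have rE : r ^+ 2 * (2 ^+ k) ^+ 2 = n%:R.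
  by rewrite /r expr_div_n divfK ?expf_neq0 ?gt_eqF // sqr_sqrtr.
have r0 : 0 < r by apply: lt_le_trans r1.
pose i := Num.truncn (p / r).
have pr0 : 0 <= p / r by apply: divr_ge0; exact: ltW.
have /andP[] := truncn_itv pr0; rewrite -/i ler_pdivlMr // ltr_pdivrMr //.
rewrite -natr1 mulrDl mul1r => y1 y2.
exists i.
  rewrite ltnS; apply: le_truncn; rewrite ler_pdivrMr //.
  by rewrite ler_pMr.
apply: (@le_trans _ _ (expR (2 - p ^+ 2 / 2) *
  expR (i%:R / 2 ^+ k * partial_sum x n - n%:R * ((i%:R / 2 ^+ k) ^+ 2 / 2)))).
  rewrite -expRD -[leLHS]expR0 ler_expR.
  have h1 : i%:R * r * p <= i%:R / 2 ^+ k * partial_sum x n.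
    have -> : i%:R * r * p = i%:R / 2 ^+ k * (Num.sqrt n%:R * p).
      by rewrite /r; ring.
    by rewrite ler_wpM2l // divr_ge0 // ltW.
  have -> : n%:R * ((i%:R / 2 ^+ k) ^+ 2 / 2) = (i%:R * r) ^+ 2 / 2.
    by rewrite -rE; field; rewrite gt_eqF.
  move: h1 y1 y2; set y := i%:R * r; set Z := _ / _ * _ => h1 y1 y2.
  have : (p - y) ^+ 2 <= 4 by nra.
  by nra.
by rewrite ler_wpM2l ?expR_ge0 // expmart_ge.
Qed.

Lemma can_force_upper (R : realType) (alpha B : R) (psi : R -> R) :
  0 < alpha ->
  {in `[1, +oo[, forall l, 0 < psi l} ->
  {in `[1, +oo[ &, {homo psi : l m / l <= m}} ->
  (forall m, \sum_(k < m) efkp_weight (psi (4 ^+ k)) <= B) ->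
  can_force alpha
    [set x | \forall n \near \oo,
               partial_sum x n < Num.sqrt n%:R * psi n%:R].
Proof.
move=> alpha0 psi_gt0 psi_nd psiB.
pose p k := psi (4 ^+ k).
have p0 k : 0 < p k by apply: psi_gt0; exact: pow4_itv.
pose m k := (Num.truncn (p k)).+1.
pose c k := expR (2 - p k ^+ 2 / 2).
pose V k : strategy R := mix (c k) (fun i => i%:R / 2 ^+ k) (m k).
(* Crossing the boundary during block k implies this event, since [p k] is at most [psi] there;
   [V k] is tuned to the level [p k]. *)
pose P k : pred (seq R) := fun s => [&& (4 ^ k <= size s)%N,
  (size s < 4 ^ k.+1)%N & Num.sqrt (size s)%:R * p k <= \sum_(y <- s) y].
have Vge0 k x n : reality_path x -> 0 <= capital ((m k)%:R * c k) (V k) x n.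
  move=> xp; rewrite capital_mix //; apply: sumr_ge0 => i _.
  by rewrite mulr_ge0 ?expR_ge0 // ltW // expmart_gt0.
(* The number [m k] of slopes is at most [p k + 1], hence at most (1 + 1 / psi 1) times [p k]. *)
apply: (@can_force_borel_cantelli R alpha (expR 2 * (1 + (psi 1)^-1) * B) _
    (fun k => (m k)%:R * c k) (fun k => stopped (P k) (V k))) => //.
- move=> k x xp n; have [j _ [-> _ _]] := capital_stopped (P k) ((m k)%:R * c k) (V k) x n.
  exact: Vge0.
- move=> K.
  have psi1 : 0 < psi 1 by apply: psi_gt0; rewrite in_itv /= lexx.
  apply: (@le_trans _ _ (\sum_(k < K)
     expR 2 * (1 + (psi 1)^-1) * efkp_weight (psi (4 ^+ k)))); last first.
    rewrite -mulr_sumr ler_pM2l // mulr_gt0 ?expR_gt0 // addr_gt0 //.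
    by rewrite invr_gt0.
  apply: ler_sum => k _; rewrite /c /m /efkp_weight -/(p k) expRD.
  rewrite -(mulNr (p k ^+ 2)) mulrCA -mulrA ler_pM2l ?expR_gt0 // mulrA.
  rewrite ler_wpM2r ?expR_ge0 // mulrDl mul1r -natr1 lerD //.
    by rewrite truncn_le ltW.
  rewrite mulrC ler_pdivlMr // mul1r; apply: psi_nd; rewrite ?pow4_itv //.
    by rewrite in_itv /= lexx.
  exact: pow4_ge1.
- move=> x xp nE K.
  have [n Kn Sn] : exists2 n, (4 ^ K <= n)%N &
      Num.sqrt n%:R * psi n%:R <= partial_sum x n.
    apply: contrapT => nex; apply: nE; exists (4 ^ K)%N => // n /= Kn.
    by rewrite ltNge; apply/negP => h; apply: nex; exists n.
  have n0 : (0 < n)%N by apply: leq_trans Kn; rewrite expn_gt0.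
  have /andP[kn nk] := @trunc_log_bounds 4 n isT n0.
  pose k := trunc_log 4 n; rewrite -/k in kn nk.
  have Sp : Num.sqrt n%:R * p k <= partial_sum x n.
    apply: le_trans Sn; rewrite ler_wpM2l ?sqrtr_ge0 //.
    apply: psi_nd; rewrite ?pow4_itv ?in_itv /= ?andbT ?ler1n //.
    by rewrite -natrX ler_nat.
  exists k; first by rewrite trunc_log_max // (leq_trans _ Kn).
  exists n => // n' /= nn'.
  have Pn : P k (mkseq x n) by rewrite /P size_mkseq sum_mkseq kn nk.
  (* Betting may have stopped at a time j earlier than n, but [P k] holds at j too, and
     [expmart_crossing] is applied there. *)
  have [j _ [Pj ->]] := capital_stopped_reached ((m k)%:R * c k) (V k) nn' Pn.
  rewrite capital_mix //; move: Pj.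
  rewrite /P size_mkseq sum_mkseq => /and3P[kj jk Sj].
  have [i im] := expmart_crossing (p0 k) kj jk Sj.
  move/le_trans; apply; rewrite (bigD1 (Ordinal im)) //= lerDl.
  by apply: sumr_ge0 => l _; rewrite mulr_ge0 ?expR_ge0 // ltW // expmart_gt0.
Qed.

(** * The lower class *)

Lemma expRN_le (R : realType) (y : R) : 0 <= y -> expR (- y) <= (1 + y)^-1.
Proof.
move=> y0; rewrite expRN lef_pV2 ?posrE ?expR_gt0 ?expR_ge1Dx //; lra.
Qed.

Lemma sum_expR_up (R : realType) (r q : R) (n : nat) : 0 < r ->
  \sum_(i < n | q <= i%:R * r) expR (q - i%:R * r) <= (1 - expR (- r))^-1.
Proof.
move=> r0; have z1 : expR (- r) < 1 by rewrite expR_lt1 oppr_lt0.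
have z0 := expR_gt0 (- r); set z := expR (- r) in z1 z0 *.
have d0 : 0 < (1 - z)^-1 by rewrite invr_gt0 subr_gt0.
have dE : (1 - z)^-1 * (1 - z) = 1 by rewrite mulVf // gt_eqF // subr_gt0.
set d := (1 - z)^-1 in d0 dE *.
pose F n := \sum_(i < n | q <= i%:R * r) expR (q - i%:R * r).
rewrite -/(F n).
(* Either no term has occurred yet, or the partial sum plus the full geometric tail from n on is at
   most d. *)
suff [->|h] : F n = 0 \/ F n + expR (q - n%:R * r) * d <= d.
- exact: ltW.
- by have := mulr_ge0 (expR_ge0 (q - n%:R * r)) (ltW d0); lra.
elim: n => [|n IH]; first by left; rewrite /F big_ord0.
have -> : F n.+1 = F n + (if q <= n%:R * r then expR (q - n%:R * r) else 0).
  by rewrite /F big_mkcond big_ord_recr /= -big_mkcond.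
have tE : expR (q - n.+1%:R * r) = expR (q - n%:R * r) * z.
  by rewrite /z -expRD -natr1; congr expR; ring.
rewrite tE; have t0 := expR_gt0 (q - n%:R * r).
have t1 : q <= n%:R * r -> expR (q - n%:R * r) <= 1.
  by move=> h; rewrite expR_le1 subr_le0.
set t := expR _ in t0 t1 IH *.
have tz : t * z * d = t * d - t.
  have : t * z * d = t * d - t * (d * (1 - z)) by ring.
  by rewrite dE mulr1.
case: ifP => [/t1 {}t1|_]; last first.
  case: IH => [->|IH]; first by left; rewrite addr0.
  by right; rewrite addr0 tz; lra.
right; case: IH => [->|IH]; last by rewrite tz; lra.
have : t * d <= 1 * d by rewrite ler_wpM2r // ltW.
by rewrite tz add0r; lra.
Qed.

Lemma sum_expR_down (R : realType) (r q : R) (n : nat) : 0 < r ->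
  \sum_(i < n | i%:R * r < q) expR (i%:R * r - q) <= (1 - expR (- r))^-1.
Proof.
move=> r0; have z1 : expR (- r) < 1 by rewrite expR_lt1 oppr_lt0.
have z0 := expR_gt0 (- r); set z := expR (- r) in z1 z0 *.
have d0 : 0 < (1 - z)^-1 by rewrite invr_gt0 subr_gt0.
have dE : (1 - z)^-1 * (1 - z) = 1 by rewrite mulVf // gt_eqF // subr_gt0.
set d := (1 - z)^-1 in d0 dE *.
pose F n := \sum_(i < n | i%:R * r < q) expR (i%:R * r - q).
(* The second bound compares with the infinite geometric series going down from the term of index n
   - 1; it feeds the induction for the first. *)
suff [//] : F n <= d /\ F n <= expR (n%:R * r - q) * z * d.
elim: n => [|n [IH1 IH2]].
  by rewrite /F big_ord0; split; rewrite ?mulr_ge0 ?expR_ge0 // ltW.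
have -> : F n.+1 = F n + (if n%:R * r < q then expR (n%:R * r - q) else 0).
  by rewrite /F big_mkcond big_ord_recr /= -big_mkcond.
have tE : expR (n.+1%:R * r - q) * z = expR (n%:R * r - q).
  by rewrite /z -expRD -natr1; congr expR; ring.
rewrite tE; have t0 := expR_gt0 (n%:R * r - q).
have t1 : n%:R * r < q -> expR (n%:R * r - q) <= 1.
  by move=> h; rewrite expR_le1 subr_le0 ltW.
set t := expR _ in t0 t1 IH1 IH2 *.
have tz : t * z * d = t * d - t.
  have : t * z * d = t * d - t * (d * (1 - z)) by ring.
  by rewrite dE mulr1.
rewrite tz in IH2; case: ifP => [/t1 {}t1|_]; last by rewrite addr0; split; lra.
have : t * d <= 1 * d by rewrite ler_wpM2r // ltW.
by split; lra.
Qed.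

(** Each side of q is dominated by a geometric series of ratio exp(-r), and 1 - exp(-r) >= r / (1 +
    r). The bound is uniform in q and n. *)
Lemma sum_expR_dist (R : realType) (r q : R) (n : nat) : 0 < r ->
  \sum_(i < n) expR (- `|i%:R * r - q|) <= 2 * (1 + r^-1).
Proof.
move=> r0.
have dle : (1 - expR (- r))^-1 <= 1 + r^-1.
  have -> : 1 + r^-1 = (1 - (1 + r)^-1)^-1.
    by field; rewrite !gt_eqF //; lra.
  have h := expRN_le (ltW r0).
  have : (1 + r)^-1 < 1 by rewrite invf_lt1; lra.
  move=> h2; rewrite lef_pV2 ?posrE; lra.
rewrite (bigID (fun i : 'I_n => q <= i%:R * r)) /= mulrDl mul1r lerD //.
  apply: le_trans dle; apply: le_trans (sum_expR_up q n r0).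
  by apply: ler_sum => i qi; rewrite ger0_norm ?subr_ge0 // opprB.
apply: le_trans dle; apply: le_trans (sum_expR_down q n r0).
rewrite (eq_bigl (fun i : 'I_n => i%:R * r < q)); last by move=> i; rewrite ltNge.
by apply: ler_sum => i qi; rewrite ltr0_norm ?subr_lt0 // opprK.
Qed.

(** * One block of martingales at scale 4^k *)

Section block.
Context (R : realType) (p q : R) (k : nat).
Context (p_ge2 : 2 <= p) (p_le : 400 * p ^+ 4 <= 4 ^+ k).
Context (q_ge0 : 0 <= q) (q_le : q ^+ 2 <= p ^+ 2 + 1).

(** In use, [p] and [q] bound [psi] up to the times 4^k and 4^(k+2). With numerators at least p,
    below the boundary at time 4^(k+2) every slope exceeds twice the optimal one, S_n / n, so the
    martingales have become small. *)
Definition slope (i : nat) : R := ((Num.truncn p).+1 + i)%:R / 2 ^+ k.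

Definition block_weight : R := (Num.truncn p).+1%:R * expR (- p ^+ 2 / 2).

Definition block_bet : strategy R :=
  mix (expR (- p ^+ 2 / 2)) slope (Num.truncn p).+1.

Definition block_value (x : nat -> R) (n : nat) : R :=
  \sum_(i < (Num.truncn p).+1) expR (- p ^+ 2 / 2) * expmart (slope i) x n.

Lemma capital_block_bet x n : reality_path x ->
  capital block_weight block_bet x n = block_value x n.
Proof. exact: capital_mix. Qed.

Let k20 : 0 < 2 ^+ k :> R. Proof. by rewrite exprn_gt0. Qed.

Let pow4E : 4 ^+ k = (2 ^+ k) ^+ 2 :> R.
Proof. by rewrite -exprM mulnC exprM expr2 -natrM. Qed.

Let count_itv : p <= (Num.truncn p).+1%:R <= p + 1.
Proof.
have p2 := p_ge2.
have p0 : 0 <= p by lra.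
have /andP[h1 h2] := truncn_itv p0.
by rewrite (ltW h2) -natr1 lerD2r.
Qed.

Let numerator_itv (i : 'I_(Num.truncn p).+1) :
  p <= ((Num.truncn p).+1 + i)%:R <= 3 * p.
Proof.
have p2 := p_ge2.
have /andP[h1 h2] := count_itv.
have hi : i%:R + 1 <= (Num.truncn p).+1%:R :> R.
  by rewrite natr1 ler_nat ltn_ord.
have i0 : (0 : R) <= i%:R by rewrite ler0n.
rewrite natrD; apply/andP; split; lra.
Qed.

Let slope_ge0 i : 0 <= slope i.
Proof. by rewrite divr_ge0 // ltW. Qed.

Let slope_le (i : 'I_(Num.truncn p).+1) : slope i <= 3 * p / 2 ^+ k.
Proof.
have /andP[_ h] := numerator_itv i.
by rewrite ler_wpM2r // invr_ge0 ltW.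
Qed.

Let slope_le1 (i : 'I_(Num.truncn p).+1) : slope i <= 1.
Proof.
have p2 := p_ge2.
apply: le_trans (slope_le i) _; rewrite ler_pdivrMr // mul1r.
rewrite -(@ler_pXn2r _ 2) ?nnegrE ?(ltW k20) //; last by lra.
rewrite -pow4E; apply: le_trans p_le.
have : 4 <= p ^+ 2 by nra.
rewrite exprMn (_ : p ^+ 4 = p ^+ 2 * p ^+ 2); last by rewrite -exprD.
nra.
Qed.

(** The quartic error of [expmart_le] is at most 324 p^4 / 4^k, whence the 400 in the hypothesis on
    p. *)
Let slope4_le (i : 'I_(Num.truncn p).+1) n : (n <= 4 ^ k.+2)%N ->
  n%:R * (slope i ^+ 4 / 4) <= 1.
Proof.
have p2 := p_ge2.
move=> nk; have nk' : (n%:R : R) <= 16 * 4 ^+ k.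
  by rewrite (_ : 16 * 4 ^+ k = (4 ^ k.+2)%:R) ?ler_nat // natrX !exprS; ring.
have h4 : slope i ^+ 4 <= (3 * p / 2 ^+ k) ^+ 4.
  by rewrite lerXn2r ?nnegrE ?slope_ge0 ?(le_trans (slope_ge0 i) (slope_le i)).
have h : (3 * p / 2 ^+ k) ^+ 4 * (4 * (4 ^+ k)) <= 1.
  rewrite pow4E (_ : _ * _ = 324 * p ^+ 4 / 4 ^+ k); last first.
    by rewrite pow4E; field; rewrite gt_eqF.
  rewrite ler_pdivrMr ?exprn_gt0 // mul1r; apply: le_trans p_le.
  by rewrite ler_wpM2r ?ler_nat // exprn_ge0 //; lra.
have s0 : 0 <= slope i ^+ 4 by rewrite exprn_ge0.
apply: le_trans h; apply: (@le_trans _ _ (16 * 4 ^+ k * (slope i ^+ 4 / 4))).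
  by rewrite ler_wpM2r // divr_ge0.
have : 0 < 4 ^+ k :> R by rewrite exprn_gt0.
nra.
Qed.

Let log_value (i : nat) (x : nat -> R) (n : nat) : R :=
  slope i * partial_sum x n - n%:R * (slope i ^+ 2 / 2).

Let expmart_le_log_value (i : 'I_(Num.truncn p).+1) x n :
  (n <= 4 ^ k.+2)%N -> expmart (slope i) x n <= expR (log_value i x n + 1).
Proof.
move=> nk; apply: le_trans (expmart_le _ _ _) _; rewrite ler_expR.
have := slope4_le i nk; rewrite /log_value mulrBr; lra.
Qed.

Let slope_sqrt i n :
  slope i * Num.sqrt n%:R =
  ((Num.truncn p).+1 + i)%:R * (Num.sqrt n%:R / 2 ^+ k).
Proof. by rewrite /slope; ring. Qed.

Let nat_slope_sqr i n :
  n%:R * (slope i ^+ 2 / 2) = (slope i * Num.sqrt n%:R) ^+ 2 / 2.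
Proof. by rewrite [(slope i * _) ^+ 2]exprMn sqr_sqrtr //; ring. Qed.

(** Put y = g sqrt n. Completing the square bounds each term by exp(3 - |y - q|): the 3 adds 1/2
    from q^2 <= p^2 + 1, 1 from the overshoot of S_n, 1 from the quartic error and 1/2 from |t| <=
    t^2 / 2 + 1/2. As r >= 1/8, [sum_expR_dist] gives 2 * (1 + 8) = 18. *)
Lemma block_value_near x n :
  (4 ^ k <= 64 * n)%N -> (n <= 4 ^ k.+2)%N ->
  partial_sum x n <= Num.sqrt n%:R * q + 1 ->
  block_value x n <= 18 * expR 3.
Proof.
have p2 := p_ge2; have qp2 := q_le.
move=> kn nk Sle; pose r : R := Num.sqrt n%:R / 2 ^+ k.
have r8 : 8^-1 <= r.
  rewrite ler_pdivlMr // ler_pdivrMl // -sqrt_pow4.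
  rewrite (_ : 8 = Num.sqrt 64); last first.
    by rewrite (_ : 64 = 8 ^+ 2) ?sqrtr_sqr ?ger0_norm // expr2 -natrM.
  by rewrite -sqrtrM // ler_wsqrtr // -natrX -natrM ler_nat.
have r0 : 0 < r by apply: lt_le_trans r8; rewrite invr_gt0.
apply: (@le_trans _ _ (\sum_(i < (Num.truncn p).+1)
    expR 3 * expR (- `|i%:R * r - (q - (Num.truncn p).+1%:R * r)|))).
  apply: ler_sum => i _.
  apply: (@le_trans _ _ (expR (- p ^+ 2 / 2) * expR (log_value i x n + 1))).
    by rewrite ler_wpM2l ?expR_ge0 // expmart_le_log_value.
  rewrite -!expRD ler_expR /log_value nat_slope_sqr.
  have hS : slope i * partial_sum x n <= slope i * Num.sqrt n%:R * q + 1.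
    apply: (@le_trans _ _ (slope i * (Num.sqrt n%:R * q + 1))).
      by rewrite ler_wpM2l // slope_ge0.
    by have := slope_le1 i; rewrite mulrDr mulr1 mulrA; lra.
  rewrite (_ : _ - (q - _) = slope i * Num.sqrt n%:R - q); last first.
    by rewrite slope_sqrt natrD /r; ring.
  move: hS; set y := slope i * Num.sqrt _; set Z := slope i * _ => hS.
  have : `|y - q| <= (y - q) ^+ 2 / 2 + 1 / 2.
    rewrite -real_normK ?num_real //.
    have := sqr_ge0 (`|y - q| - 1); nra.
  nra.
rewrite -mulr_sumr mulrC ler_wpM2r ?expR_ge0 //.
apply: le_trans (sum_expR_dist _ _ r0) _.
have : r^-1 <= 8 by rewrite -[leRHS]invrK lef_pV2 ?posrE ?invr_gt0.
lra.
Qed.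

(* At time 4^(k+2) the exponent is 4 j q - 8 j^2 with j >= p, and q <= 3 p / 2. *)
Lemma block_value_frozen (e : R) x :
  expR (1 - 2 * p ^+ 2) <= e ->
  partial_sum x (4 ^ k.+2) <= Num.sqrt (4 ^ k.+2)%:R * q ->
  block_value x (4 ^ k.+2) <= e * block_weight.
Proof.
have p2 := p_ge2; have q0 := q_ge0; have qp2 := q_le.
move=> pe Sle.
have sE : Num.sqrt (4 ^ k.+2)%:R = 4 * 2 ^+ k :> R.
  by rewrite natrX sqrt_pow4 !exprS; ring.
apply: (@le_trans _ _ (\sum_(i < (Num.truncn p).+1) expR (- p ^+ 2 / 2) * e)).
  apply: ler_sum => i _; rewrite ler_wpM2l ?expR_ge0 //.
  apply: le_trans (expmart_le_log_value i x (leqnn _)) _.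
  apply: le_trans pe; rewrite ler_expR /log_value nat_slope_sqr.
  have yE : slope i * Num.sqrt (4 ^ k.+2)%:R =
      4 * ((Num.truncn p).+1 + i)%:R.
    by rewrite slope_sqrt sE; field; rewrite gt_eqF.
  have := ler_wpM2l (slope_ge0 i) Sle; rewrite mulrA yE.
  have /andP[j1 _] := numerator_itv i.
  move: j1; set j := (_ + _)%:R => j1; set Z := slope i * _ => hS.
  have qp : q <= 3 / 2 * p.
    rewrite -(@ler_pXn2r _ 2) ?nnegrE //; nra.
  nra.
by rewrite sumr_const card_ord /block_weight -[leLHS]mulr_natl mulrA mulrC.
Qed.

Lemma block_value_small_sum (e : R) x n :
  0 <= e -> e <= 1 ->
  (forall i : 'I_(Num.truncn p).+1, slope i * partial_sum x n <= e / 2) ->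
  block_value x n <= (1 + e) * block_weight.
Proof.
move=> e0 e1 Se.
apply: (@le_trans _ _
    (\sum_(i < (Num.truncn p).+1) expR (- p ^+ 2 / 2) * (1 + e))).
  apply: ler_sum => i _; rewrite ler_wpM2l ?expR_ge0 //.
  apply: le_trans (expmart_le_exp _ _ _) _.
  apply: (@le_trans _ _ (expR (e / 2))); first by rewrite ler_expR.
  rewrite -[e / 2]opprK expRN.
  have h := expR_ge1Dx (- (e / 2)).
  (* Since e <= 1, (1 + e)(1 - e / 2) >= 1. *)
  apply: (@le_trans _ _ (1 - e / 2)^-1).
    by rewrite lef_pV2 ?posrE ?expR_gt0 //; lra.
  by rewrite -[leLHS]mul1r ler_pdivrMr; nra.
by rewrite sumr_const card_ord /block_weight -[leLHS]mulr_natl mulrA mulrC.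
Qed.

(* Either all g S_n <= e / 2, or p^2 is at least of order 1 / r and the weight
   exp (- p^2 / 2) is negligible with respect to r. *)
Lemma block_value_far (e : R) x n :
  0 < e -> e <= 1 -> 12 * p <= e * 2 ^+ k ->
  (64 * n <= 4 ^ k)%N ->
  partial_sum x n <= Num.sqrt n%:R * p + 1 ->
  block_value x n <=
    (1 + e) * block_weight + 12 * (256 * expR 1) / e * (Num.sqrt n%:R / 2 ^+ k).
Proof.
have p2 := p_ge2.
move=> e0 e1 pe nk Sle; pose r : R := Num.sqrt n%:R / 2 ^+ k; rewrite -/r.
have r0 : 0 <= r by rewrite divr_ge0 ?sqrtr_ge0 // ltW.
have r8 : r <= 8^-1.
  rewrite ler_pdivrMr // ler_pdivlMl // -sqrt_pow4.
  rewrite (_ : 8 = Num.sqrt 64); last first.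
    by rewrite (_ : 64 = 8 ^+ 2) ?sqrtr_sqr ?ger0_norm // expr2 -natrM.
  by rewrite -sqrtrM // ler_wsqrtr // -natrX -natrM ler_nat.
have w0 : 0 <= block_weight by rewrite mulr_ge0 ?expR_ge0.
have K0 : 0 <= 12 * (256 * expR 1) / e.
  apply: divr_ge0; last exact: ltW.
  apply: mulr_ge0; first exact: ler0n.
  by apply: mulr_ge0; [exact: ler0n | exact: expR_ge0].
have ge4 (i : 'I_(Num.truncn p).+1) : slope i <= e / 4.
  apply: le_trans (slope_le i) _.
  by rewrite ler_pdivrMr //; lra.
have hS (i : 'I_(Num.truncn p).+1) :
    slope i * partial_sum x n <= 3 * p ^+ 2 * r + slope i.
  apply: (@le_trans _ _ (slope i * (Num.sqrt n%:R * p + 1))).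
    by rewrite ler_wpM2l // slope_ge0.
  rewrite mulrDr mulr1 lerD2r mulrA slope_sqrt -/r.
  have /andP[_ j2] := numerator_itv i; move: j2; set j := (_ + _)%:R => j2.
  have : j * (r * p) <= 3 * p * (r * p) by rewrite ler_wpM2r // mulr_ge0 //; lra.
  nra.
have [small|large] := lerP (3 * p ^+ 2 * r) (e / 4).
  apply: (@le_trans _ _ ((1 + e) * block_weight)); last first.
    by rewrite lerDl mulr_ge0.
  apply: block_value_small_sum => //; first exact: ltW.
  by move=> i; have := hS i; have := ge4 i; lra.
apply: (@le_trans _ _ (12 * (256 * expR 1) / e * r)); last first.
  by rewrite lerDr mulr_ge0 //; lra.
have p0 : 0 < p by lra.
have p2r : (p ^+ 2)^-1 <= 12 * r / e.
  rewrite ler_pdivlMr // mulrC ler_pdivrMr ?exprn_gt0 //; nra.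
have key : expR (- p ^+ 2 / 8) <= 128 / p ^+ 4.
  rewrite mulNr expRN -[leRHS]invrK invf_div lef_pV2 ?posrE ?expR_gt0 ?divr_gt0
    ?exprn_gt0 //.
  have h0 : 0 <= p ^+ 2 / 8 by rewrite divr_ge0 ?exprn_ge0 // ltW.
  apply: le_trans (expR_ge1Dxn 1 h0); rewrite (_ : 2`! = 2)%N //.
  by rewrite (_ : (p ^+ 2 / 8) ^+ 2 / 2 = p ^+ 4 / 128); [lra | field].
apply: (@le_trans _ _ (\sum_(i < (Num.truncn p).+1) expR 1 * (128 / p ^+ 4))).
  apply: ler_sum => i _.
  apply: (@le_trans _ _ (expR (- p ^+ 2 / 2) * expR (slope i * partial_sum x n))).
    by rewrite ler_wpM2l ?expR_ge0 // expmart_le_exp.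
  (* Because r <= 1/8, the exponent - p^2 / 2 + 3 p^2 r + g is at most 1 - p^2 / 8. *)
  apply: (@le_trans _ _ (expR 1 * expR (- p ^+ 2 / 8))); last first.
    by rewrite ler_wpM2l ?expR_ge0.
  rewrite -!expRD ler_expR.
  have := hS i; have := slope_le1 i; have : 0 <= p ^+ 2 by exact: sqr_ge0.
  nra.
rewrite sumr_const card_ord -[leLHS]mulr_natl.
have /andP[_ h1] := count_itv.
have e10 := expR_gt0 (1 : R).
(* At most 2 p terms of order p^-4 leave p^-3, which is at most p^-2 and hence of order r / e by
   [p2r]. *)
apply: (@le_trans _ _ (2 * p * (expR 1 * (128 / p ^+ 4)))).
  apply: ler_wpM2r; last by lra.
  apply: mulr_ge0; first exact: ltW.
  by apply: divr_ge0; [exact: ler0n | exact/exprn_ge0/ltW].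
have -> : 2 * p * (expR 1 * (128 / p ^+ 4)) = 256 * expR 1 * (p^-1 * (p ^+ 2)^-1).
  by field; rewrite gt_eqF.
have -> : 12 * (256 * expR 1) / e * r = 256 * expR 1 * (12 * r / e).
  by field; rewrite gt_eqF.
apply: ler_wpM2l; first by apply: mulr_ge0; [exact: ler0n | exact: ltW].
apply: le_trans p2r; rewrite -[leRHS]mul1r ler_wpM2r ?invr_ge0 ?sqr_ge0 //.
by rewrite invf_le1 //; lra.
Qed.

(** There are three regimes: up to time N the slopes are too small to matter; for n of order 4^k the
    value is bounded by a constant and r >= 1/8; for earlier n, [block_value_far] applies. The error
    is linear in r = sqrt n / 2^k so that it can be summed over k. *)
Lemma block_value_le (e : R) (N : nat) x n :
  0 < e -> e <= 1 -> (0 < N)%N -> 12 * p * N%:R <= e * 2 ^+ k ->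
  (n <= 4 ^ k.+2)%N ->
  ((n <= N)%N -> partial_sum x n <= N%:R) ->
  ((N < n)%N -> partial_sum x n <= Num.sqrt n%:R * q + 1) ->
  ((N < n)%N -> (n <= 4 ^ k)%N -> partial_sum x n <= Num.sqrt n%:R * p + 1) ->
  block_value x n <=
    (1 + e) * block_weight + 12 * (256 * expR 3) / e * (Num.sqrt n%:R / 2 ^+ k).
Proof.
have p2 := p_ge2.
move=> e0 e1 N0 pNe nk S1 S2 S3.
pose r : R := Num.sqrt n%:R / 2 ^+ k; rewrite -/r.
have r0 : 0 <= r by rewrite divr_ge0 ?sqrtr_ge0 // ltW.
have w0 : 0 <= block_weight by rewrite mulr_ge0 ?expR_ge0.
have K0 : 0 <= 12 * (256 * expR 3) / e.
  apply: divr_ge0; last exact: ltW.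
  apply: mulr_ge0; first exact: ler0n.
  by apply: mulr_ge0; [exact: ler0n | exact: expR_ge0].
have N1 : 1 <= N%:R :> R by rewrite ler1n.
have [nN|Nn] := leqP n N.
  apply: (@le_trans _ _ ((1 + e) * block_weight)); last first.
    by rewrite lerDl mulr_ge0.
  apply: block_value_small_sum => //; first exact: ltW.
  move=> i; apply: (@le_trans _ _ (3 * p / 2 ^+ k * N%:R)).
    apply: (@le_trans _ _ (slope i * N%:R)).
      by rewrite ler_wpM2l ?slope_ge0 // S1.
    by rewrite ler_wpM2r // slope_le.
  by rewrite mulrAC ler_pdivrMr //; nra.
have [near|/ltnW far] := leqP (4 ^ k) (64 * n).
  apply: le_trans (block_value_near near nk (S2 Nn)) _.
  apply: (@le_trans _ _ (12 * (256 * expR 3) / e * r)); last first.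
    by rewrite lerDr mulr_ge0 //; lra.
  have r8 : 8^-1 <= r.
    rewrite ler_pdivlMr // ler_pdivrMl // -sqrt_pow4.
    rewrite (_ : 8 = Num.sqrt 64); last first.
      by rewrite (_ : 64 = 8 ^+ 2) ?sqrtr_sqr ?ger0_norm // expr2 -natrM.
    by rewrite -sqrtrM // ler_wsqrtr // -natrX -natrM ler_nat.
  have -> : 12 * (256 * expR 3) / e * r = expR 3 * (12 * (256 * r) / e) by ring.
  rewrite mulrC ler_wpM2l ?expR_ge0 // ler_pdivlMr //; nra.
apply: le_trans (block_value_far e0 e1 _ far (S3 Nn _)) _.
- by apply: le_trans pNe; rewrite ler_peMr //; lra.
- by apply: leq_trans far; rewrite leq_pmull.
- rewrite lerD2l ler_wpM2r // ler_wpM2r ?invr_ge0 ?(ltW e0) //.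
  do 2 (apply: ler_wpM2l; first exact: ler0n).
  by rewrite ler_expR ler1n.
Qed.

End block.

(** * Choice of the blocks *)

Lemma sum_scale_le (R : realType) (y : R) (K : nat) : 0 <= y ->
  \sum_(k < K | y <= 4 * 2 ^+ k) y / 2 ^+ k <= 8.
Proof.
move=> y0; pose F K := \sum_(k < K | y <= 4 * 2 ^+ k) y / 2 ^+ k.
rewrite -/(F K).
have pos k : 0 <= y / 2 ^+ k by rewrite divr_ge0 // exprn_ge0.
(* The terms halve and the first is at most 4; the added summand is the whole tail from K on. *)
suff [->//|h] : F K = 0 \/ F K + 2 * (y / 2 ^+ K) <= 8.
  by have := pos K; lra.
elim: K => [|K IH]; first by left; rewrite /F big_ord0.
have -> : F K.+1 = F K + (if y <= 4 * 2 ^+ K then y / 2 ^+ K else 0).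
  by rewrite /F big_mkcond big_ord_recr /= -big_mkcond.
have k20 : 0 < 2 ^+ K :> R by rewrite exprn_gt0.
have E : 2 * (y / 2 ^+ K.+1) = y / 2 ^+ K.
  by rewrite exprS; field; rewrite gt_eqF.
have := pos K; rewrite E; case: ifP => [yK|_] yK0; last first.
  by case: IH => [->|IH]; [left; rewrite addr0 | right; lra].
right; case: IH => [->|IH]; last by lra.
have : y / 2 ^+ K <= 4 by rewrite ler_pdivrMr.
lra.
Qed.

(* The first condition keeps the boundary from rising while the block is active,
   the second makes cosh g ^ n comparable to exp (g^2 n / 2) for its slopes, and the
   third (with c = 12 N / e) makes the block insensitive to the first N rounds. *)
Definition good_block (R : realType) (p : nat -> R) (c : R) (k : nat) : bool :=
  [&& p k.+2 ^+ 2 <= p k ^+ 2 + 1, 400 * p k ^+ 4 <= 4 ^+ k &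
      c * p k <= 2 ^+ k].

(** The bound exp(t) >= t^3 / 6 at t = p^2 / 2 even gives 48 / p^5. *)
Lemma efkp_weight_le_pow4 (R : realType) (p : R) : 1 <= p ->
  efkp_weight p <= 48 / p ^+ 4.
Proof.
move=> p1; have p0 : 0 < p by lra.
have h0 : 0 <= p ^+ 2 / 2 by rewrite divr_ge0 ?exprn_ge0 // ltW.
have := expR_ge1Dxn 2 h0; rewrite (_ : 3`! = 6)%N // => h.
have h6 : p ^+ 6 / 48 <= expR (p ^+ 2 / 2).
  by apply: le_trans h; rewrite (_ : (p ^+ 2 / 2) ^+ 3 / 6 = p ^+ 6 / 48);
    [lra | field].
rewrite /efkp_weight mulNr expRN ler_pdivrMr ?expR_gt0 //.
apply: (@le_trans _ _ (48 / p ^+ 4 * (p ^+ 6 / 48))); last first.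
  by apply: ler_wpM2l => //; apply: divr_ge0; [exact: ler0n | exact/exprn_ge0/ltW].
have -> : 48 / p ^+ 4 * (p ^+ 6 / 48) = p ^+ 2 by field; rewrite gt_eqF.
nra.
Qed.

(* If the first condition fails then 1 / p_k^2 - 1 / p_(k+2)^2 >= 1 / (2 p_k^4), which
   telescopes; if one of the others fails then p_k^-4 = O(4^-k). *)
Lemma sum_bad_blocks (R : realType) (p : nat -> R) (c : R) : 1 <= c ->
  (forall k, 1 <= p k) -> {homo p : i j / (i <= j)%N >-> i <= j} ->
  exists C, forall K, \sum_(k < K) efkp_weight (p k) <=
    C + \sum_(k < K | good_block p c k) efkp_weight (p k).
Proof.
move=> c1 p1 p_nd.
pose u k := (p k ^+ 2)^-1.
pose D := 48 * (400 + c ^+ 2).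
have D0 : 0 <= D.
  apply: mulr_ge0; first exact: ler0n.
  by apply: addr_ge0; [exact: ler0n | exact: sqr_ge0].
have pt k : efkp_weight (p k) <= 96 * (u k - u k.+2) + D / 4 ^+ k +
    (if good_block p c k then efkp_weight (p k) else 0).
  have p0 : 0 < p k by apply: lt_le_trans (p1 k).
  have pq : p k <= p k.+2 by apply: p_nd; rewrite -addn2 leq_addr.
  have q0 : 0 < p k.+2 by apply: lt_le_trans pq.
  have k40 : 0 < 4 ^+ k :> R by rewrite exprn_gt0.
  have u0 : 0 <= u k - u k.+2.
    rewrite subr_ge0 lef_pV2 ?posrE ?exprn_gt0 //.
    by rewrite ler_pXn2r ?nnegrE ?(ltW p0) ?(ltW q0).
  have Dk0 : 0 <= D / 4 ^+ k by rewrite divr_ge0 // ltW.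
  have wle := efkp_weight_le_pow4 (p1 k).
  have p40 : 0 < p k ^+ 4 by rewrite exprn_gt0.
  have iE (a : R) : 48 / p k ^+ 4 <= a <-> 48 <= a * p k ^+ 4.
    by rewrite ler_pdivrMr.
  have weak (t : R) : 4 ^+ k <= t * p k ^+ 4 -> t <= 400 + c ^+ 2 ->
      efkp_weight (p k) <= D / 4 ^+ k.
    move=> ht tD; apply: (le_trans wle); apply/iE.
    rewrite /D mulrAC ler_pdivlMr // -!mulrA; apply: ler_wpM2l; first exact: ler0n.
    apply: (le_trans ht); apply: ler_wpM2r => //; exact: ltW.
  rewrite /good_block.
  have [h1|h1] /= := lerP (p k.+2 ^+ 2) (p k ^+ 2 + 1); last first.
    rewrite addr0; apply: (@le_trans _ _ (96 * (u k - u k.+2))); last by lra.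
    apply: (le_trans wle); apply/iE.
    have h : (p k ^+ 2)^-1 - (p k ^+ 2 + 1)^-1 <= u k - u k.+2.
      rewrite lerD2l lerN2 lef_pV2 ?posrE ?exprn_gt0 ?addr_gt0 ?exprn_gt0 //.
      exact: ltW.
    (* The factor 96 is 48 * 2, because p^2 + 1 <= 2 p^2. *)
    apply: (@le_trans _ _ (96 * ((p k ^+ 2)^-1 - (p k ^+ 2 + 1)^-1) * p k ^+ 4)).
      have P1 : 1 <= p k ^+ 2 by rewrite exprn_ege1.
      have -> : 96 * ((p k ^+ 2)^-1 - (p k ^+ 2 + 1)^-1) * p k ^+ 4 =
          96 * p k ^+ 2 / (p k ^+ 2 + 1).
        by field; rewrite !gt_eqF //; lra.
      by rewrite ler_pdivlMr; lra.
    apply: ler_wpM2r; first exact: ltW.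
    by apply: ler_wpM2l => //; exact: ler0n.
  have [h2|h2] /= := lerP (400 * p k ^+ 4) (4 ^+ k); last first.
    rewrite addr0; apply: (@le_trans _ _ (D / 4 ^+ k)); last by lra.
    apply: (weak 400); first exact: ltW.
    by have := sqr_ge0 c; lra.
  have [h3|h3] := lerP (c * p k) (2 ^+ k); first by lra.
  rewrite addr0; apply: (@le_trans _ _ (D / 4 ^+ k)); last by lra.
  apply: (weak (c ^+ 2)); last by lra.
  apply: (@le_trans _ _ ((c * p k) ^+ 2)).
    rewrite (_ : 4 ^+ k = (2 ^+ k) ^+ 2); last first.
      by rewrite -exprM mulnC exprM expr2 -natrM.
    rewrite lerXn2r ?nnegrE ?exprn_ge0 ?(ltW h3) //; nra.
  rewrite exprMn; apply: ler_wpM2l; first exact: sqr_ge0.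
  by apply: ler_weXn2l; first exact: p1.
(* The telescoping sum is at most u 0 + u 1 <= 2, and the powers 4^-k sum to at most 4/3. *)
exists (192 + 2 * D) => K.
have tel : \sum_(k < K) (u k - u k.+2) = u 0%N + u 1%N - u K - u K.+1.
  elim: K => [|K IH]; first by rewrite big_ord0; ring.
  by rewrite big_ord_recr /= IH; ring.
have geo : \sum_(k < K) (4 ^+ k)^-1 = 4 / 3 * (1 - (4 ^+ K)^-1) :> R.
  elim: K {tel} => [|K IH]; first by rewrite big_ord0 expr0 invr1 subrr mulr0.
  rewrite big_ord_recr /= IH exprS; field.
  by rewrite expf_neq0 // pnatr_eq0.
have ub k : 0 <= u k <= 1.
  rewrite invr_ge0 sqr_ge0 invf_le1 ?exprn_ege1 // exprn_gt0 //.
  by apply: lt_le_trans (p1 k).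
have K40 : 0 <= (4 ^+ K)^-1 :> R by rewrite invr_ge0 exprn_ge0.
apply: (@le_trans _ _ (\sum_(k < K) (96 * (u k - u k.+2) + D / 4 ^+ k +
    (if good_block p c k then efkp_weight (p k) else 0)))).
  by apply: ler_sum.
rewrite !big_split /= -!mulr_sumr -big_mkcond tel geo.
have /andP[a1 a2] := ub 0%N; have /andP[b1 b2] := ub 1%N.
have /andP[c2 c3] := ub K; have /andP[d1 d2] := ub K.+1.
set s := \sum_(_ < _ | _) _.
have : D * (4 / 3 * (1 - (4 ^+ K)^-1)) <= 2 * D by nra.
lra.
Qed.

(** * Selling the blocks short *)

Lemma pow2_le_pow4 k : (2 ^ k <= 4 ^ k.+2)%N.
Proof. by rewrite (_ : 4 = 2 ^ 2)%N // -expnM leq_exp2l //; lia. Qed.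

(** Betting stops at the first crossing, where the boundary may already be exceeded, but by at most
    one step. This is the source of the + 1 in the block estimates. *)
Lemma uncrossed_next (R : realType) (psi : R -> R) x n :
  reality_path x ->
  {in `[1, +oo[, forall l, 0 < psi l} ->
  {in `[1, +oo[ &, {homo psi : l m / l <= m}} ->
  (0 < n)%N -> partial_sum x n < Num.sqrt n%:R * psi n%:R ->
  partial_sum x n.+1 <= Num.sqrt n.+1%:R * psi n.+1%:R + 1.
Proof.
move=> xp psi_gt0 psi_nd n0 /ltW h.
have itv j : (0 < j)%N -> (j%:R : R) \in `[1, +oo[.
  by move=> j0; rewrite in_itv /= andbT ler1n.
rewrite /partial_sum big_ord_recr /= -/(partial_sum x n).
have h1 : x n <= 1 by case: (xp n) => ->; lra.
apply: lerD => //; apply: (le_trans h).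
apply: ler_pM; rewrite ?sqrtr_ge0 //.
- by apply/ltW/psi_gt0/itv.
- by rewrite ler_wsqrtr // ler_nat.
- by apply: psi_nd; rewrite ?itv // ler_nat.
Qed.

Lemma partial_sum_le (R : realType) (x : nat -> R) n :
  reality_path x -> partial_sum x n <= n%:R.
Proof.
move=> xp; rewrite /partial_sum.
apply: (@le_trans _ _ (\sum_(i < n) 1)).
  by apply: ler_sum => i _; case: (xp i) => ->; lra.
by rewrite sumr_const card_ord.
Qed.

(** The initial capital is arbitrarily small, so that strategies for all N can be run together at
    finite total cost. *)
Lemma lower_strategy (R : realType) (psi : R -> R) (e : R) (N : nat) :
  {in `[1, +oo[, forall l, 0 < psi l} ->
  {in `[1, +oo[ &, {homo psi : l m / l <= m}} ->
  (forall B, exists m, B <= \sum_(k < m) efkp_weight (psi (4 ^+ k))) ->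
  0 < e -> e <= 1 -> (0 < N)%N ->
  exists v, exists M : strategy R,
    [/\ v <= 2 * e,
        forall x, reality_path x -> forall n, 0 <= capital v M x n &
        forall x, reality_path x ->
          (forall n, (N <= n)%N ->
             partial_sum x n < Num.sqrt n%:R * psi n%:R) ->
          \forall n \near \oo, 1 <= capital v M x n].
Proof.
move=> psi_gt0 psi_nd psioo e0 e1 N0.
have N1 : 1 <= N%:R :> R by rewrite ler1n.
(* Truncating [psi] from below at A gives p >= 2 and makes exp(1 - 2 p^2) at most e, as
   [block_value_frozen] requires. *)
pose A : R := 2 / e.
have A2 : 2 <= A by rewrite ler_pdivlMr //; lra.
pose p k := Num.max (psi (4 ^+ k)) A.
have pA k : A <= p k by rewrite /p le_max lexx orbT.
have p2 k : 2 <= p k by apply: le_trans (pA k).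
have ppsi k : psi (4 ^+ k) <= p k by rewrite /p le_max lexx.
have psile n k : (0 < n)%N -> (n <= 4 ^ k)%N -> psi n%:R <= p k.
  move=> n0 nk; apply: le_trans (ppsi k); apply: psi_nd.
  - by rewrite in_itv /= andbT ler1n.
  - exact: pow4_itv.
  - by rewrite -natrX ler_nat.
have p_nd : {homo p : i j / (i <= j)%N >-> i <= j}.
  move=> i j ij; rewrite /p ge_max le_max [X in _ && X]le_max lexx orbT andbT.
  by rewrite psi_nd ?pow4_itv // ler_weXn2l // ler1n.
pose c := 12 * N%:R / e.
have c1 : 1 <= c by rewrite ler_pdivlMr // mul1r; lra.
pose G k := good_block p c k.
pose W K := \sum_(k < K | G k) block_weight (p k).
have w_ge0 k : 0 <= block_weight (p k) by rewrite mulr_ge0 ?expR_ge0.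
pose C8 := 8 * (12 * (256 * expR 3) / e).
(* [C8] bounds the total error of all the blocks at any time; with W this large the error is at most
   e W. *)
have [K WK] : exists K, C8 / e + 1 <= W K.
  have p1 k : 1 <= p k by apply: le_trans (p2 k); lra.
  have [C HC] := sum_bad_blocks c1 p1 p_nd.
  have A0 : 0 < A by lra.
  have wA := efkp_weight_gt0 A0.
  have [K HK] := psioo ((C8 / e + 1 + C) / efkp_weight A).
  exists K; rewrite ler_pdivrMr // in HK.
  (* Truncation keeps the divergence: each new weight is either the old one or that of A, and both
     factors on the left are at most 1. *)
  have h1 : (\sum_(k < K) efkp_weight (psi (4 ^+ k))) * efkp_weight A <=
      \sum_(k < K) efkp_weight (p k).
    rewrite mulr_suml; apply: ler_sum => k _; rewrite /p /Order.max.
    case: ifP => _.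
      rewrite -[leRHS]mul1r; apply: ler_wpM2r; first exact: ltW.
      exact: efkp_weight_le1.
    rewrite -[leRHS]mulr1; apply: ler_wpM2l; last exact: efkp_weight_le1.
    by apply/ltW/efkp_weight_gt0/psi_gt0/pow4_itv.
  have h2 : \sum_(k < K | G k) efkp_weight (p k) <= W K.
    apply: ler_sum => k _; rewrite /efkp_weight /block_weight.
    by apply: ler_wpM2r; [exact: expR_ge0 | exact/ltW/truncnS_gt].
  have := HC K; lra.
set w := W K in WK.
have C80 : 0 <= C8.
  apply: mulr_ge0; first exact: ler0n.
  apply: divr_ge0; last exact: ltW.
  apply: mulr_ge0; first exact: ler0n.
  by apply: mulr_ge0; [exact: ler0n | exact: expR_ge0].
have w0 : 0 < w by apply: lt_le_trans WK; rewrite ltr_wpDl // divr_ge0 // ltW.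
have C8w : C8 <= e * w.
  by rewrite mulrC -ler_pdivrMr //; apply: le_trans WK; lra.
pose D k x n := block_value (p k) k x (minn n (4 ^ k.+2)).
pose Q x n := \sum_(k < K | G k) D k x n.
(* Selling Q for w with a reserve of 2 e w is worth (1 + 2e) w - Q, which is at least (1 + e) w once
   Q <= e w; [c0] scales this to 1. *)
pose c0 := ((1 + e) * w)^-1.
have c00 : 0 < c0 by rewrite invr_gt0 mulr_gt0 //; lra.
have c0E : c0 * ((1 + e) * w) = 1.
  by rewrite mulVf // gt_eqF // mulr_gt0 //; lra.
pose v := c0 * ((1 + 2 * e) * w + -1 * w).
pose M : strategy R := fun s => c0 * (-1 * \sum_(k < K | G k)
  (if (size s < 4 ^ k.+2)%N then block_bet (p k) k s else 0)).
have capE x n : reality_path x ->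
    capital v M x n = c0 * ((1 + 2 * e) * w - Q x n).
  move=> xp; rewrite capitalZ capitalD capitalZ capital_sum mulN1r.
  congr (c0 * (_ - _)); apply: eq_bigr => k _.
  by rewrite capital_freeze capital_block_bet.
pose P : pred (seq R) := fun s => (N <= size s)%N &&
  (Num.sqrt (size s)%:R * psi (size s)%:R <= \sum_(y <- s) y).
have PE x n : P (mkseq x n) =
    (N <= n)%N && (Num.sqrt n%:R * psi n%:R <= partial_sum x n).
  by rewrite /P size_mkseq sum_mkseq.
have goodP k : G k -> [/\ p k.+2 ^+ 2 <= p k ^+ 2 + 1,
    400 * p k ^+ 4 <= 4 ^+ k & 12 * p k * N%:R <= e * 2 ^+ k].
  move=> /and3P[g1 g2 g3]; split=> //; move: g3.
  by rewrite /c mulrAC ler_pdivrMr // mulrAC (mulrC e).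
have TN k : G k -> (N <= 4 ^ k.+2)%N.
  move=> /goodP[_ _ h]; rewrite -(ler_nat R).
  apply: (@le_trans _ _ (2 ^+ k)).
    have := p2 k; have k20 : 0 < 2 ^+ k :> R by rewrite exprn_gt0.
    nra.
  by rewrite -natrX ler_nat pow2_le_pow4.
have q0 k : 0 <= p k by have := p2 k; lra.
have frozen x k n : G k ->
    (forall i, (i < n)%N -> ~~ P (mkseq x i)) -> (4 ^ k.+2 < n)%N ->
    D k x n <= e * block_weight (p k).
  move=> Gk nP kn; rewrite /D (minn_idPr (ltnW kn)).
  have [g1 g2 _] := goodP k Gk.
  apply: (block_value_frozen (q := p k.+2)) => //.
  - rewrite -opprB expRN -[leRHS]invrK lef_pV2 ?posrE ?expR_gt0 ?invr_gt0 //.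
    apply: le_trans (expR_ge1Dx _).
    have h : A ^+ 2 <= p k ^+ 2.
      by rewrite lerXn2r ?nnegrE ?(q0 k) //; lra.
    have -> : e^-1 = A / 2 by rewrite /A; field; rewrite gt_eqF.
    nra.
  - have := nP _ kn; rewrite PE TN //= -ltNge => /ltW h.
    apply: (le_trans h); rewrite ler_wpM2l ?sqrtr_ge0 //.
    by apply: psile => //; rewrite expn_gt0.
(* Only the times before n are assumed uncrossed, so that n may be the stopping time itself. *)
have Qle x n : reality_path x -> (forall i, (i < n)%N -> ~~ P (mkseq x i)) ->
    Q x n <= (1 + 2 * e) * w.
  move=> xp nP.
  have S2 k : (N < n)%N -> (n <= 4 ^ k)%N ->
      partial_sum x n <= Num.sqrt n%:R * p k + 1.
    move=> Nn nk; case: n Nn nk nP => // n Nn nk nP.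
    have h : partial_sum x n < Num.sqrt n%:R * psi n%:R.
      by have := nP n (ltnSn n); rewrite PE -ltnS Nn /= -ltNge.
    apply: le_trans (uncrossed_next xp psi_gt0 psi_nd _ h) _.
      exact: leq_trans N0 _.
    by rewrite lerD2r ler_wpM2l ?sqrtr_ge0 // psile.
  apply: (@le_trans _ _ (\sum_(k < K | G k) ((1 + e) * block_weight (p k) +
      (if Num.sqrt n%:R <= 4 * 2 ^+ k :> R
       then C8 / 8 * (Num.sqrt n%:R / 2 ^+ k) else 0)))).
    apply: ler_sum => k Gk; have [g1 g2 g3] := goodP k Gk.
    have [nk|kn] := leqP n (4 ^ k.+2).
      rewrite ifT; last first.
        apply: (@le_trans _ _ (Num.sqrt (4 ^ k.+2)%:R)).
          by rewrite ler_wsqrtr // ler_nat.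
        by rewrite natrX sqrt_pow4 !exprS mulrA -natrM.
      rewrite /D (minn_idPl nk).
      have -> : C8 / 8 = 12 * (256 * expR 3) / e by rewrite /C8 mulrAC divff ?mul1r.
      apply: (block_value_le (p2 k) g2 g1 e0 e1 N0) => //.
      - by move=> nN; apply: le_trans (partial_sum_le n xp) _; rewrite ler_nat.
      - by move=> Nn; exact: S2.
      - by move=> Nn nk'; exact: S2.
    apply: (@le_trans _ _ ((1 + e) * block_weight (p k))).
      apply: le_trans (frozen x k n Gk nP kn) _.
      by apply: ler_wpM2r => //; lra.
    rewrite lerDl; case: ifP => // _; apply: mulr_ge0.
      exact: divr_ge0.
    by rewrite divr_ge0 ?sqrtr_ge0 // exprn_ge0.
  rewrite big_split /= -mulr_sumr -/(W K) -/w.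
  have h8 : \sum_(k < K | G k) (if Num.sqrt n%:R <= 4 * 2 ^+ k :> R
       then C8 / 8 * (Num.sqrt n%:R / 2 ^+ k) else 0) <= C8 / 8 * 8.
    apply: (@le_trans _ _ (C8 / 8 *
        \sum_(k < K | Num.sqrt n%:R <= 4 * 2 ^+ k :> R) Num.sqrt n%:R / 2 ^+ k)).
      rewrite mulr_sumr [leRHS]big_mkcond [leLHS]big_mkcond /=.
      apply: ler_sum => k _; case: (G k) => //; case: ifP => // _.
      apply: mulr_ge0; first exact: divr_ge0.
      by rewrite divr_ge0 ?sqrtr_ge0 // exprn_ge0.
    apply: ler_wpM2l; first exact: divr_ge0.
    by apply: sum_scale_le; exact: sqrtr_ge0.
  have : C8 / 8 * 8 <= e * w by rewrite divfK.
  lra.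
exists v; exists (stopped P M); split.
- rewrite /v (_ : _ + _ = 2 * e * w); last by ring.
  rewrite /c0 mulrC ler_pdivrMr; first by nra.
  by rewrite mulr_gt0 //; lra.
- move=> x xp n; have [m _ [-> nP _]] := capital_stopped P v M x n.
  by rewrite capE // mulr_ge0 ?(ltW c00) // subr_ge0 Qle.
- move=> x xp unc; exists (4 ^ K.+2)%N => // n /= Kn.
  have nP i : ~~ P (mkseq x i).
    rewrite PE; apply/negP => /andP[Ni]; apply/negP; rewrite -ltNge.
    exact: unc.
  have [m _ [-> _ mP]] := capital_stopped P v M x n.
  case: mP => [->|Pm]; last by rewrite (negbTE (nP m)) in Pm.
  rewrite capE // -[leLHS]c0E; apply: ler_wpM2l; first exact: ltW.
  suff : Q x n <= e * w by lra.
  rewrite /w /W mulr_sumr; apply: ler_sum => k Gk.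
  apply: frozen => //; apply: leq_trans Kn.
  by rewrite ltn_exp2l // !ltnS.
Qed.

Lemma can_force_lower (R : realType) (alpha : R) (psi : R -> R) :
  0 < alpha ->
  {in `[1, +oo[, forall l, 0 < psi l} ->
  {in `[1, +oo[ &, {homo psi : l m / l <= m}} ->
  (forall B, exists m, B <= \sum_(k < m) efkp_weight (psi (4 ^+ k))) ->
  can_force alpha
    [set x | infinite_set
               [set n | (1 <= n)%N /\
                        Num.sqrt n%:R * psi n%:R <= partial_sum x n]].
Proof.
move=> alpha0 psi_gt0 psi_nd psioo.
(* The costs 2 e N then have total at most 4. *)
pose e (N : nat) : R := (2 ^+ N)^-1.
have e0 N : 0 < e N by rewrite invr_gt0 exprn_gt0.
have e1 N : e N <= 1 by rewrite invf_le1 ?exprn_gt0 // exprn_ege1 // ler1n.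
have strat N : {vM : R * strategy R | [/\ vM.1 <= 2 * e N,
    forall x, reality_path x -> forall n, 0 <= capital vM.1 vM.2 x n &
    forall x, reality_path x ->
      (forall n, (N < n)%N -> partial_sum x n < Num.sqrt n%:R * psi n%:R) ->
      \forall n \near \oo, 1 <= capital vM.1 vM.2 x n]}.
  apply: cid.
  have [v [M [h1 h2 h3]]] :=
    lower_strategy psi_gt0 psi_nd psioo (e0 N) (e1 N) (ltn0Sn N).
  by exists (v, M).
apply: (@can_force_borel_cantelli R alpha 4 _
  (fun N => (sval (strat N)).1) (fun N => (sval (strat N)).2)) => //.
- by move=> N; case: (svalP (strat N)).
- move=> m; apply: (@le_trans _ _ (\sum_(N < m) 2 * e N)).
    by apply: ler_sum => N _; case: (svalP (strat N)).
  rewrite -mulr_sumr (_ : \sum_(_ < _) _ = 2 - 2 * e m).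
    by have := e0 m; lra.
  elim: m => [|m IH]; first by rewrite big_ord0 /e expr0 invr1; ring.
  rewrite big_ord_recr /= IH /e exprS; field.
  by rewrite expf_neq0 // pnatr_eq0.
- move=> x xp /contrapT fin K.
  (* Finitely many crossings leave a last one, and every strategy whose index is at least its time
     succeeds. *)
  have [N0 HN0] : exists N0, forall n, (N0 < n)%N ->
      partial_sum x n < Num.sqrt n%:R * psi n%:R.
    have /finite_seqP[s sE] := fin.
    exists (\max_(i <- s) i)%N => n sn; rewrite ltNge; apply/negP => h.
    have : n \in s.
      suff : [set` s] n by [].
      by rewrite -sE; split => //; exact: leq_ltn_trans sn.
    by move=> /(@leq_bigmax_seq _ s xpredT id n) /(_ isT); rewrite leqNgt sn.
  exists (maxn K N0); first exact: leq_maxl.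
  have [_ _ h] := svalP (strat (maxn K N0)); apply: h => // n hn.
  by apply: HN0; apply: leq_ltn_trans hn; exact: leq_maxr.
Qed.

Theorem theorem1p1 (R : realType) (alpha : R) (psi : R -> R)
    (alpha_gt0 : 0 < alpha)
    (psi_gt0 : {in `[1, +oo[, forall l, 0 < psi l})
    (psi_nd : {in `[1, +oo[ &, {homo psi : l m / l <= m}})
    (psi_cont : {within `[1, +oo[, continuous psi}) :
  ((psi_integral psi < +oo)%E ->
    can_force alpha
      [set x | \forall n \near \oo,
                 partial_sum x n < Num.sqrt n%:R * psi n%:R]) /\
  (psi_integral psi = +oo%E ->
    can_force alpha
      [set x | infinite_set
                 [set n | (1 <= n)%N /\
                          Num.sqrt n%:R * psi n%:R <= partial_sum x n]]).
Proof.
split=> I.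
- have [B HB] := efkp_series_bounded psi_gt0 psi_nd psi_cont I.
  exact: (can_force_upper alpha_gt0 psi_gt0 psi_nd HB).
- apply: (can_force_lower alpha_gt0 psi_gt0 psi_nd).
  exact: (efkp_series_unbounded psi_gt0 psi_nd psi_cont I).
Qed.
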